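(* Let $f:Y\to X$ be an affine map of compact convex sets and let $P$ be a convex polytope. Assume $\dim(\mathrm{Im} f)=\dim X\le\dim P$. Then there exists a natural injective affine map $$\rho:\ S(P,f)\amalg C(P,f)\ \to\ \varprojlim C(\tilde{\mathbb{F}}(P),f).$$ Moreover: (a) The map $\rho$ is bijective if $P$ is simple and not an $n$-gon with $n\ge4$. (b) The map $\rho$ is non-bijective if $f(Y)\subset\mathrm{relint}(X)$ and there is a vertex $v\in P$ such that (i) the facets of $P$ through $v$ are simplices, and (ii) $P$ is not a pyramid with apex at $v$.
   Context: All vector spaces are finite-dimensional and real. Affine maps between subsets of vector spaces are maps respecting barycentric coordinates. $\mathrm{relint}$ denotes relative interior. For compact convex sets $A,B$, $\mathrm{Hom}(A,B)$ is the set of affine maps $A\to B$, a compact convex subset of the affine space of affine maps $\mathrm{Aff}(A)\to\mathrm{Aff}(B)$. $\mathbf{Comp}$ is the category of compact subsets of vector spaces and affine maps. For $Z$ compact convex and $f:Y\to X$ affine between compact convex sets define $$S(Z,f)=\{g\in\mathrm{Hom}(Z,X)\mid f(Y)\subset g(Z)\},$$ $$C(Z,f)=\overline{\{g\in\mathrm{Hom}(Z,X)\mid g(Z)\cap\mathrm{relint}(\mathrm{Im} f)=\emptyset\}}$$ (closure in the Euclidean topology; $S$ is ''sandwiching'' and $C$ is ''complementing''). When $\dim(\mathrm{Im} f)=\dim X$, the set in the definition of $C(Z,f)$ is already closed, and $S(Z,f)$ and $C(Z,f)$ are disjoint subsets of $\mathrm{Hom}(Z,X)$; $S(P,f)\amalg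 C(P,f)$ denotes their union. $\tilde{\mathbb{F}}(P)$ is the poset of all proper faces of $P$, ordered by inclusion and viewed as a category. $C(\tilde{\mathbb{F}}(P),f)$ is the contravariant functor $\tilde{\mathbb{F}}(P)\to\mathbf{Comp}$ given by $F\mapsto C(F,f)$ and, for $F\subset G$, by restriction $C(G,f)\to C(F,f)$, $g\mapsto g|_F$. Its limit $\varprojlim C(\tilde{\mathbb{F}}(P),f)$ is identified with the space of continuous maps $\gamma:\partial P\to X$ that are affine on each proper face and satisfy $\gamma|_F\in C(F,f)$ for every proper face $F$ of $P$. The natural map $\rho$ meant is restriction to the boundary, $\rho(g)=g|_{\partial P}$.
   Formalization: When dim X < dim P it is additionally assumed that S(P,f) is empty, since otherwise restriction to the boundary sends no element of S(P,f) into the limit (e.g. X = Y a point, P a segment); Y is taken nonempty. *)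

(* Defs.v *)
(* MathComp-Analysis. A vector space is R^n, i.e. 'rV[R]_n over R : realType.
   A map defined on a subset A of V is a function on the subtype A (through the
   coercion set_type), so that maps on A are compared on A only. *)
From HB Require Import structures.
From mathcomp Require Import all_boot all_order all_algebra.
From mathcomp Require Import all_classical all_reals all_analysis.
Set Implicit Arguments.
Unset Strict Implicit.
Unset Printing Implicit Defensive.
Import Order.TTheory GRing.Theory Num.Theory.
Import numFieldNormedType.Exports.
Local Open Scope classical_set_scope.
Local Open Scope ring_scope.

Section AffineGeometry.
Variables (R : realType) (V W : lmodType R).

Definition affine_hull (A : set V) : set V :=
  [set y | exists k (x : 'I_k -> V) (t : 'I_k -> R),
    [/\ forall i, A (x i), \sum_i t i = 1 & y = \sum_i t i *: x i]].

Definition convex_hull (A : set V) : set V :=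
  [set y | exists k (x : 'I_k -> V) (t : 'I_k -> R),
    [/\ forall i, A (x i), forall i, 0 <= t i, \sum_i t i = 1 &
        y = \sum_i t i *: x i]].

(* The subset A need not be convex: an affine combination of points of A is
   respected whenever it lies in A. *)
Definition affine_map (A : set V) (g : A -> W) : Prop :=
  forall k (x : 'I_k -> A) (t : 'I_k -> R) (y : A),
    \sum_i t i = 1 -> set_val y = \sum_i t i *: set_val (x i) ->
    g y = \sum_i t i *: g (x i).

Definition affinely_independent k (x : 'I_k -> V) : Prop :=
  forall t : 'I_k -> R,
    \sum_i t i = 0 -> \sum_i t i *: x i = 0 -> forall i, t i = 0.

(* The empty set is a polytope. *)
Definition polytope (P : set V) : Prop :=
  exists2 A : set V, finite_set A & P = convex_hull A.

Definition simplex (P : set V) : Prop :=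
  exists k (x : 'I_k -> V), affinely_independent x /\ P = convex_hull (range x).

(* The faces include P itself (l = 0, c = 0), and the empty set. *)
Definition face (P F : set V) : Prop :=
  exists (l : {scalar V}) (c : R),
    (forall x, P x -> l x <= c) /\ F = [set x | P x /\ l x = c].

Definition proper_face (P F : set V) : Prop := face P F /\ F <> P.

Definition vertex (P : set V) (v : V) : Prop := face P [set v].

(* The base Q may be empty: a point is a pyramid over its empty facet. *)
Definition pyramid_with_apex (P : set V) (v : V) : Prop :=
  exists Q : set V,
    [/\ polytope Q, ~ affine_hull Q v & P = convex_hull (Q `|` [set v])].

End AffineGeometry.

Section Dimension.
Variables (R : realType) (V : vectType R).
Implicit Type A : set V.

(* The linear subspace parallel to the affine hull of A, for A nonempty. *)
Definition direction A : {vspace V} :=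
  xget 0%VS [set U : {vspace V} | forall v, v \in U <->
    exists x y, [/\ affine_hull A x, affine_hull A y & v = y - x]].

(* dim A, with the convention dim set0 = -1. *)
Definition adim A : int :=
  if `[< A = set0 >] then (-1)%R else (\dim (direction A))%:Z.

Lemma affine_hull_comb A x y z (a : R) :
  affine_hull A x -> affine_hull A y -> affine_hull A z ->
  affine_hull A (x + a *: (y - z)).
Proof.
move=> [k1 [x1 [t1 [A1 s1 ->]]]] [k2 [x2 [t2 [A2 s2 ->]]]].
move=> [k3 [x3 [t3 [A3 s3 ->]]]].
pose X i := match fintype.split i with inl i1 => x1 i1 | inr j =>
  match fintype.split j with inl i2 => x2 i2 | inr i3 => x3 i3 end end.
pose T i := match fintype.split i with inl i1 => t1 i1 | inr j =>
  match fintype.split j with inl i2 => a * t2 i2 | inr i3 => - a * t3 i3 end end.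
exists (k1 + (k2 + k3))%N, X, T; split.
- by move=> i; rewrite /X; case: (fintype.split i) => // j; case: (fintype.split j).
- rewrite big_split_ord/= big_split_ord/=.
  under eq_bigr => i _ do rewrite /T (unsplitK (inl i)).
  under [X in _ + (X + _)]eq_bigr => i _ do
    rewrite /T (unsplitK (inr _)) (unsplitK (inl i)).
  under [X in _ + (_ + X)]eq_bigr => i _ do
    rewrite /T (unsplitK (inr _)) (unsplitK (inr i)).
  by rewrite -!mulr_sumr s1 s2 s3 !mulr1 subrr addr0.
- rewrite big_split_ord/= big_split_ord/=.
  under [X in _ = X + _]eq_bigr => i _ do
    rewrite /T /X (unsplitK (inl i)).
  under [X in _ = _ + (X + _)]eq_bigr => i _ do
    rewrite /T /X (unsplitK (inr _)) (unsplitK (inl i)) -scalerA.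
  under [X in _ = _ + (_ + X)]eq_bigr => i _ do
    rewrite /T /X (unsplitK (inr _)) (unsplitK (inr i)) -scalerA.
  by rewrite -!scaler_sumr scaleNr -scalerBr.
Qed.

Lemma sub_affine_hull A : A `<=` affine_hull A.
Proof.
move=> x Ax; exists 1, (fun=> x), (fun=> 1); split=> //.
  by rewrite big_ord1.
by rewrite big_ord1 scale1r.
Qed.

Lemma directionP A v : A !=set0 ->
  v \in direction A <->
  exists x y, [/\ affine_hull A x, affine_hull A y & v = y - x].
Proof.
move=> [a Aa]; pose D := [set v | exists x y,
  [/\ affine_hull A x, affine_hull A y & v = y - x]].
have aA := sub_affine_hull Aa.
have D_lin (c : R) u w : D u -> D w -> D (u + c *: w).
  move=> [x [y [Ax Ay ->]]] [z [t [Az At ->]]].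
  exists x, (y + c *: (t - z)); split=> //; first exact: affine_hull_comb.
  by rewrite addrAC.
have D0 : D 0 by exists a, a; rewrite subrr.
pose Q d := `[< exists U : {vspace V}, (forall u, u \in U -> D u) /\ \dim U = d >].
have Q0 : exists d, Q d.
  exists 0; apply/asboolP; exists 0%VS; split; last exact: dimv0.
  by move=> u; rewrite memv0 => /eqP ->.
have Qb d : Q d -> (d <= \dim {:V})%N.
  by move=> /asboolP[U [_ <-]]; apply/dimvS/subvf.
have [d /asboolP[U [UD Ud]] dmax] := ex_maxnP Q0 Qb.
suff ex : [set U : {vspace V} | forall v, v \in U <-> D v] U.
  exact: (@xgetPex _ 0%VS _ (ex_intro _ U ex)).
move=> w; split; first exact: UD.
move=> Dw; apply/negPn/negP => wU.
have := dmax (\dim (U + <[w]>)%VS).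
have QU : Q (\dim (U + <[w]>)%VS).
  apply/asboolP; exists (U + <[w]>)%VS; split=> // z.
  move=> /memv_addP[u uU].
  by move=> [_ /vlineP[c ->] ->]; apply: D_lin => //; exact: UD.
move=> /(_ QU); rewrite -Ud => le_dim.
have /eqP eqU : U == (U + <[w]>)%VS.
  by rewrite eqEdim addvSl.
by move: wU; rewrite eqU (subvP (addvSr _ _)) // memv_line.
Qed.

Definition facet (P F : set V) : Prop := face P F /\ adim F = adim P - 1.

Definition simple_polytope (P : set V) : Prop :=
  polytope P /\
  forall v, vertex P v -> ([set F | facet P F /\ F v] #= `I_(absz (adim P)))%card.

Definition ngon (n : nat) (P : set V) : Prop :=
  [/\ polytope P, adim P = 2 & (vertex P #= `I_n)%card].

End Dimension.

Section RelativeTopology.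
Variables (R : realType) (n : nat).
Implicit Types A P F : set 'rV[R]_n.

Definition relint A : set 'rV[R]_n :=
  [set x | A x /\ within (affine_hull A) (nbhs x) A].

Definition boundary P : set 'rV[R]_n := P `\` relint P.

Lemma boundary_sub P : boundary P `<=` P.
Proof. by move=> x []. Qed.

Lemma proper_face_boundary P F : proper_face P F -> F `<=` boundary P.
Proof.
move=> [[l [c [lc FE]]] FP] x; rewrite FE => -[Px lx]; split=> // -[_ nx].
have [p [Pp lp]] : exists p, P p /\ l p < c.
  apply: contrapT => np; apply: FP; rewrite FE; apply/seteqP; split.
    by move=> y [].
  move=> y Py; split=> //; apply/eqP; rewrite eq_le lc//= leNgt.
  by apply/negP => yc; apply: np; exists y.
pose h (t : R) := x + t *: (x - p).
have hx : h t @[t --> 0] --> x.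
  rewrite -[X in _ --> X]addr0 -(scale0r (x - p)).
  by apply: cvgD; [exact: cvg_cst | apply: cvgZr_tmp; exact: cvg_id].
have H : \forall t \near (0:R)^'+, affine_hull P (h t) -> P (h t).
  by have /(_ _ nx) := cvg_at_right_filter hx.
have : \forall t \near (0:R)^'+, False.
  near=> t.
  have Pt : P (h t).
    near: t; apply: filterS H => t; apply.
    by apply: affine_hull_comb; exact: sub_affine_hull.
  have := lc _ Pt; rewrite /h linearD linearZ linearB/= lx gerDl leNgt.
  by rewrite mulr_gt0// subr_gt0.
by move=> /filter_ex[].
Unshelve. all: by end_near.
Qed.

End RelativeTopology.

Section AffineHom.
Variables (R : realType) (k n : nat).

Definition affine_hom (A : set 'rV[R]_k) (B : set 'rV[R]_n) :
    set (A -> 'rV[R]_n) :=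
  [set g | affine_map g /\ range g `<=` B].

End AffineHom.

Section SandwichComplement.
Variables (R : realType) (m n : nat) (Y : set 'rV[R]_m) (X : set 'rV[R]_n).
Variables (k : nat) (f : Y -> 'rV[R]_n).

Definition sandwiching (Z : set 'rV[R]_k) : set (Z -> 'rV[R]_n) :=
  [set g | affine_hom X g /\ range f `<=` range g].

(* On the finite-dimensional space of affine maps on Z, in which Hom(Z, X) is
   closed, the topology of pointwise convergence on Z is the Euclidean one. *)
Definition complementing (Z : set 'rV[R]_k) : set (Z -> 'rV[R]_n) :=
  closure ([set g | affine_hom X g /\ range g `&` relint (range f) = set0]
           : set {ptws Z -> 'rV[R]_n}).

(* The limit of C(F, f) over the proper faces F of P, as a space of maps on the
   boundary of P. *)
Definition lim_complementing (P : set 'rV[R]_k) :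
    set (boundary P -> 'rV[R]_n) :=
  [set c | [/\ continuous c, range c `<=` X &
    forall (F : set 'rV[R]_k) (pF : proper_face P F),
      affine_map (c \o subfun (proper_face_boundary pF)) /\
      complementing (c \o subfun (proper_face_boundary pF))]].

Definition restrict_boundary (P : set 'rV[R]_k) (g : P -> 'rV[R]_n) :
    boundary P -> 'rV[R]_n := g \o subfun (@boundary_sub R k P).

End SandwichComplement.

Arguments sandwiching {R m n Y} X {k} f Z.
Arguments complementing {R m n Y} X {k} f Z.
Arguments lim_complementing {R m n Y} X {k} f P.
Arguments restrict_boundary {R n k} P g.

(* Main.v *)
Require Import Defs.
From HB Require Import structures.
From mathcomp Require Import all_boot all_order all_algebra.
From mathcomp Require Import all_classical all_reals all_analysis.
From mathcomp Require Import ring lra.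
Set Implicit Arguments.
Unset Strict Implicit.
Unset Printing Implicit Defensive.
Import Order.TTheory GRing.Theory Num.Theory.
Import numFieldNormedType.Exports.
Local Open Scope classical_set_scope.
Local Open Scope ring_scope.

(** Let [K] be the relative interior of the image of [f].  As the image of [f]
    has the dimension of [X], [K] is open in [X]; so complementing maps are just
    the affine maps into [X] that avoid [K] ([complementingP]).

    Restriction to the boundary is well defined and injective.  A complementing
    map restricts to complementing maps on faces.  By hypothesis, a sandwiching
    map exists only if [P] and [X] have the same dimension; it is then
    injective, so a proper face is sent to the relative boundary of the image,
    away from [K] ([sandwiching_face]).  Injectivity holds because an affine map is determined
    by its values at the vertices ([restrict_boundary_inj]).

    (a) Let [h] be in the limit.  It suffices to extend [h] to an affine map [g]
    on [P]: if [g] meets [K], then, since [g] avoids [K] on the boundary, [g] must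
    be injective, and segments that start in [K] and end in the image of [f]
    cannot leave the image of [P], so [g] is sandwiching
    ([boundary_avoiding_sandwiching]).  When [P] is a point, a segment or a
    triangle, its vertices are affinely independent and the extension is clear
    ([few_vertices_extension]).  When [P] is simple of dimension at least three,
    it looks like an orthant at each vertex ([simple_vertex_frame]), so there is
    one affine map that extends [h] on all facets through that vertex.
    Neighbouring vertices share all facets but one, which are at least two
    in number, so they have the same affine map; and climbing along a linear
    functional connects every vertex to a given one
    ([simple_polytope_extension]).

    (b) As the facets through [v] are simplices, the weight of [v] in a convex
    combination of the vertices depends only on the point as long as that point
    is in the boundary, and it is affine on each proper face
    ([vertex_weight_affine]).  Hence one can bend [P] at [v]: send [v] to [x1]
    and the other vertices to [x0], where the segment from [x0] to [x1] lies in
    [X] and misses the image of [f].  If this map extended to an affine map on [P],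
    then [v] would be outside the affine hull of the other vertices, and [P]
    would be a pyramid with apex [v] ([restrict_boundary_not_surj]).

    The polytope theory behind this rests on Farkas' lemma ([farkas]) and on the
    fact that a vector outside a finitely generated cone is separated from it by
    a functional that exposes a facet ([cone_facet]).  They show that a polytope
    is generated by its vertices, that every proper face lies in a facet
    and that every boundary point lies on a proper face. *)

(** * Linear functionals and finitely generated cones *)

Section Functionals.
Variables (R : realType) (V : vectType R).
Implicit Types (u v w : V) (U : {vspace V}).

Lemma functional_of (h : V -> R) :
  (forall a u v, h (a *: u + v) = a * h u + h v) ->
  exists l : {scalar V}, forall x, l x = h x.
Proof.
move=> hl.
pose H := GRing.isLinear.Build R V R *%R h hl.
pose l : {scalar V} := HB.pack h H.
by exists l.
Qed.

Lemma functional_comb (l1 l2 : {scalar V}) (a b : R) :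
  exists l : {scalar V}, forall x, l x = a * l1 x + b * l2 x.
Proof.
apply: functional_of => c u v; rewrite !linearP; ring.
Qed.

Lemma functional_nonzero v : v != 0 -> exists l : {scalar V}, l v = 1.
Proof.
move=> v0.
have [i ci] : exists i, coord (vbasis {:V}) i v != 0.
  apply: contrapT => /forallNP c0.
  move: v0; rewrite (coord_vbasis (memvf v)) big1 ?eqxx// => i _.
  by have /negP/negPn/eqP -> := c0 i; rewrite scale0r.
have [|l lE] := @functional_of
    (fun x => (coord (vbasis {:V}) i v)^-1 * coord (vbasis {:V}) i x).
  by move=> a x y; rewrite linearP/= mulrDr; congr (_ + _); rewrite mulrCA.
by exists l; rewrite lE mulVf.
Qed.

(** Project along [U] onto a complement, where the image of [v] is nonzero. *)
Lemma functional_separating U v : v \notin U ->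
  exists l : {scalar V}, (forall u, u \in U -> l u = 0) /\ l v = 1.
Proof.
move=> vU.
have v0 : v - projv U v != 0.
  by apply: contra vU; rewrite subr_eq0 => /eqP ->; exact: memv_proj.
have [l l1] := functional_nonzero v0.
have [|l' l'E] := @functional_of (fun x => l (x - projv U x)).
  move=> a x y; rewrite -[RHS]linearP; congr (l _).
  by rewrite linearP/= scalerBr opprD addrACA.
exists l'; split; last by rewrite l'E.
by move=> u uU; rewrite l'E projv_id// subrr linear0.
Qed.

(** Bartl's induction.  If the inequalities of the tail do not suffice, they hold
    at some [z] where the conclusion fails; the inequality of the head [a j] must
    then fail at [z].  Subtracting from each vector the multiple of [a j] that
    makes [z] vanish on it eliminates [a j]. *)
Lemma farkas (I : eqType) (r : seq I) (a : I -> V) b : uniq r ->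
  (forall l : {scalar V}, (forall i, i \in r -> l (a i) <= 0) -> l b <= 0) ->
  exists t : I -> R, (forall i, 0 <= t i) /\ b = \sum_(i <- r) t i *: a i.
Proof.
elim: r a b => [|j r IH] a b.
  move=> _ H; exists (fun=> 0); split=> //; rewrite big_nil; apply/eqP.
  apply/negPn/negP => b0; have [l lb] := functional_nonzero b0.
  by have := H l (fun _ => ltac:(by [])); rewrite lb ler10.
rewrite cons_uniq => /andP[jr ur] H.
have ext (t : I -> R) c : 0 <= c -> (forall i, 0 <= t i) ->
    exists t' : I -> R, (forall i, 0 <= t' i) /\
    \sum_(i <- j :: r) t' i *: a i = c *: a j + \sum_(i <- r) t i *: a i.
  move=> c0 t0; exists (fun i => if i == j then c else t i); split.
    by move=> i; case: ifP.
  rewrite big_cons eqxx; congr (_ + _); apply: eq_big_seq => i ir.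
  by case: eqVneq ir jr => // -> ->.
have [H'|/existsNP[z /not_implyP[za /negP]]] := pselect
    (forall l : {scalar V}, (forall i, i \in r -> l (a i) <= 0) -> l b <= 0).
  have [t [t0 ->]] := IH a b ur H'.
  have [t' [t'0 t'E]] := ext t 0 (lexx _) t0.
  by exists t'; rewrite t'E scale0r add0r.
rewrite -ltNge => zb.
have zj : 0 < z (a j).
  rewrite ltNge; apply/negP => zj.
  suff : z b <= 0 by rewrite leNgt zb.
  by apply: H => i; rewrite inE => /orP[/eqP ->//|]; exact: za.
have zj0 : z (a j) != 0 by rewrite gt_eqF.
have [||t [t0 tE]] := IH (fun i => a i - (z (a i) / z (a j)) *: a j)
    (b - (z b / z (a j)) *: a j) => //.
  move=> l lH.
  have [l' l'E] := functional_comb l z 1 (- (l (a j) / z (a j))).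
  have lE x : l (x - (z x / z (a j)) *: a j) = l' x.
    by rewrite l'E linearB linearZ/=; field.
  rewrite lE; apply: H => i; rewrite inE => /orP[/eqP ->|ir]; last first.
    by rewrite -lE; exact: lH.
  by rewrite l'E mulNr divfK// mul1r subrr.
pose c := z b / z (a j) - \sum_(i <- r) t i * (z (a i) / z (a j)).
have c0 : 0 <= c.
  rewrite subr_ge0; apply: (@le_trans _ _ 0).
    rewrite big_seq; apply: sumr_le0 => i ir; rewrite mulr_ge0_le0//.
    by rewrite ler_pdivrMr// mul0r; exact: za.
  by rewrite divr_ge0// ltW.
have [t' [t'0 t'E]] := ext t c c0 t0.
exists t'; split=> //; rewrite t'E.
move: tE => /eqP; rewrite subr_eq => /eqP ->.
rewrite (eq_bigr (fun i => t i *: a i - (t i * (z (a i) / z (a j))) *: a j)).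
  by rewrite sumrB -scaler_suml /c scalerBl addrC addrA [RHS]addrAC.
by move=> i _; rewrite scalerBr scalerA.
Qed.

Lemma farkas_fam (I : finType) (a : I -> V) b :
  (forall l : {scalar V}, (forall i, l (a i) <= 0) -> l b <= 0) ->
  exists t : I -> R, (forall i, 0 <= t i) /\ b = \sum_i t i *: a i.
Proof.
move=> H; have [|l la|t [t0 ->]] := @farkas I (index_enum I) a b.
- exact: index_enum_uniq.
- by apply: H => i; apply: la; exact: mem_index_enum.
- by exists t.
Qed.

(** Tilt [l] in the direction of [l1] until it first vanishes at a generator
    where it was negative. *)
Lemma rotate_functional (I : finType) (a : I -> V) (l l1 : {scalar V}) :
  (forall i, l (a i) <= 0) -> (forall i, l (a i) = 0 -> l1 (a i) = 0) ->
  (exists i, 0 < l1 (a i)) ->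
  exists t, [/\ 0 < t, forall i, l (a i) + t * l1 (a i) <= 0 &
    exists i, l (a i) < 0 /\ l (a i) + t * l1 (a i) = 0].
Proof.
move=> la l10 [i0 i0P].
pose F i := - l (a i) / l1 (a i).
case: (@arg_minP _ R I i0 (fun i => 0 < l1 (a i)) F i0P) => j jP jmin.
have lj : l (a j) < 0.
  rewrite lt_neqAle la andbT; apply/eqP => /l10 lj0.
  by rewrite lj0 ltxx in jP.
exists (F j); split.
- by rewrite divr_gt0// oppr_gt0.
- move=> i; have [ip|ip] := ltP 0 (l1 (a i)).
    by have := jmin i ip; rewrite {2}/F ler_pdivlMr// => ?; lra.
  have : F j * l1 (a i) <= 0.
    by rewrite mulr_ge0_le0// divr_ge0// ?oppr_ge0// ltW.
  by have := la i; lra.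
- by exists j; split=> //; rewrite /F divfK ?gt_eqF// subrr.
Qed.

(** The span of the face of the cone generated by [a] that [l] exposes. *)
Definition zero_span (I : finType) (a : I -> V) (l : {scalar V}) : {vspace V} :=
  <<[seq a i | i <- enum I & (l (a i) == 0)%R]>>%VS.

Lemma mem_zero_span (I : finType) (a : I -> V) (l : {scalar V}) i :
  l (a i) = 0 -> a i \in zero_span a l.
Proof.
move=> li; apply: memv_span; apply/mapP; exists i => //.
by rewrite mem_filter li eqxx mem_enum.
Qed.

Lemma zero_span_sub (I : finType) (a : I -> V) (l : {scalar V}) U :
  (forall i, l (a i) = 0 -> a i \in U) -> (zero_span a l <= U)%VS.
Proof.
move=> H; apply/span_subvP => x /mapP[i]; rewrite mem_filter => /andP[/eqP li _] ->.
exact: H.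
Qed.

Lemma span_sub_functional (xs : seq V) (l : {scalar V}) u :
  u \in <<xs>>%VS -> (forall x, x \in xs -> l x = 0) -> l u = 0.
Proof.
move=> us ls; rewrite (coord_span (X := in_tuple xs) us) linear_sum big1// => i _.
by rewrite linearZ/= ls ?mulr0// mem_nth.
Qed.

(** Among the functionals separating [u] from the cone of the [a i], one whose
    zero span has the largest dimension cuts out a facet of the cone.  If it
    did not, another functional [l1] would vanish on the zero span and, after
    subtracting a multiple of [l], at one more generator [a j].  Either tilting
    [l] by [l1] or [- l1], or one of these two alone, keeps [u] separated and
    vanishes at a further generator. *)
Lemma cone_facet (I : finType) (a : I -> V) u :
  u \in <<[seq a i | i <- enum I]>>%VS ->
  ~ (exists t : I -> R, (forall i, 0 <= t i) /\ u = \sum_i t i *: a i) ->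
  exists l : {scalar V}, [/\ forall i, l (a i) <= 0, 0 < l u &
    (\dim (zero_span a l)).+1 = \dim <<[seq a i | i <- enum I]>>%VS].
Proof.
set S := <<_>>%VS => uS ncone.
have aS i : a i \in S by apply/memv_span/map_f; rewrite mem_enum.
have Sind (l : {scalar V}) v : v \in S -> (forall i, l (a i) = 0) -> l v = 0.
  move=> vS l0; apply: (span_sub_functional vS) => x /mapP[i _ ->]; exact: l0.
pose sep (l : {scalar V}) := (forall i, l (a i) <= 0) /\ 0 < l u.
pose Q d := `[< exists l, sep l /\ \dim (zero_span a l) = d >].
have [d0 Qd0] : exists d, Q d.
  have [l Hl] : exists l, sep l.
    apply: contrapT => nl; apply: ncone; apply: farkas_fam => l la.
    by rewrite leNgt; apply/negP => lu; apply: nl; exists l.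
  by exists (\dim (zero_span a l)); apply/asboolP; exists l.
have Qb d : Q d -> (d <= \dim S)%N.
  move=> /asboolP[l [_ <-]]; apply: dimvS; exact: zero_span_sub.
have [d /asboolP[l [[la lu] ld]] dmax] := ex_maxnP (ex_intro _ d0 Qd0) Qb.
exists l; split=> //; set Z := zero_span a l in ld *.
have ZS : (Z <= S)%VS by exact: zero_span_sub.
have Zl z : z \in Z -> l z = 0.
  move=> zZ; apply: (span_sub_functional zZ) => x /mapP[i].
  by rewrite mem_filter => /andP[/eqP + _] ->.
have Zmax (l2 : {scalar V}) j : sep l2 -> (forall i, l (a i) = 0 -> l2 (a i) = 0) ->
    l2 (a j) = 0 -> l (a j) < 0 -> False.
  move=> sl2 l20 l2j lj.
  have := dmax (\dim (zero_span a l2)); rewrite -ld.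
  have -> : Q (\dim (zero_span a l2)) by apply/asboolP; exists l2.
  move=> /(_ isT) dle.
  have ZZ : (Z <= zero_span a l2)%VS.
    by apply: zero_span_sub => i li; apply: mem_zero_span; exact: l20.
  have /eqP ZE : Z == zero_span a l2 by rewrite eqEdim ZZ.
  have /Zl lj0 : a j \in Z by rewrite ZE; exact: mem_zero_span.
  by rewrite lj0 ltxx in lj.
have Zu : u \notin Z.
  by apply/negP => /Zl lu0; rewrite lu0 ltxx in lu.
apply/eqP; rewrite eqn_leq; apply/andP; split.
  rewrite ltnNge; apply/negP => dle; case/negP: Zu.
  by have /eqP -> : Z == S by rewrite eqEdim ZS.
rewrite leqNgt; apply/negP => Zlt.
have [w [wS lw wZ]] : exists w, [/\ w \in S, l w = 0 & w \notin Z].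
  have : ~~ (S <= Z + <[u]>)%VS.
    apply/negP => /dimvS; rewrite leqNgt => /negP; apply.
    have [Zule _] := dimv_add_leqif Z <[u]>%VS.
    apply: (leq_ltn_trans Zule); apply: leq_ltn_trans Zlt.
    by rewrite -addn1 leq_add2l dim_vline leq_b1.
  move=> /subvPn[w0 w0S w0Z].
  exists (w0 - (l w0 / l u) *: u); split.
  - by rewrite memvB// memvZ.
  - by rewrite linearB linearZ/= divfK ?subrr// gt_eqF.
  - apply: contra w0Z => H; rewrite -(subrK ((l w0 / l u) *: u) w0).
    by rewrite memv_add// memvZ// memv_line.
have [l' [l'Z l'w]] := functional_separating wZ.
have [j lj] : exists j, l (a j) < 0.
  apply: contrapT => nj; suff: l u = 0 by move=> lu0; rewrite lu0 ltxx in lu.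
  apply: Sind => // i; apply/eqP; rewrite eq_le la leNgt; apply/negP => li.
  by apply: nj; exists i.
have lj0 : l (a j) != 0 by rewrite lt_eqF.
have [l1 l1E] := functional_comb l' l 1 (- (l' (a j) / l (a j))).
have l10 i : l (a i) = 0 -> l1 (a i) = 0.
  by move=> li; rewrite l1E li mulr0 addr0 mul1r l'Z// mem_zero_span.
have l1j : l1 (a j) = 0 by rewrite l1E mulNr divfK// mul1r subrr.
have l1w : l1 w = 1 by rewrite l1E lw mulr0 addr0 mul1r.
have rot (m : {scalar V}) : (forall i, l (a i) = 0 -> m (a i) = 0) -> 0 <= m u ->
    ~ exists i, 0 < m (a i).
  move=> m0 mu mi; have [t [t0 tle [i [li ti]]]] := rotate_functional la m0 mi.
  have [l2 l2E] := functional_comb l m 1 t.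
  apply: (Zmax l2 i) => //; first split=> [i'|].
  - by rewrite l2E mul1r.
  - by rewrite l2E mul1r ltr_wpDr// mulr_ge0// ltW.
  - by move=> i' li'; rewrite l2E li' m0// !mulr0 addr0.
  - by rewrite l2E mul1r.
have [Nl1 Nl1E] := functional_comb l1 l1 (-1) 0.
have {}Nl1E x : Nl1 x = - l1 x by rewrite Nl1E mul0r addr0 mulN1r.
have Nl10 i : l (a i) = 0 -> Nl1 (a i) = 0 
  by move=> /l10; rewrite Nl1E => ->; rewrite oppr0.
have [l1u|l1u|l1u] := ltrgt0P (l1 u).
- apply: (Zmax l1 j) => //; split=> // i; rewrite leNgt; apply/negP => li.
  by apply: (rot l1) => //; [exact: ltW|exists i].
- apply: (Zmax Nl1 j) => //; last by rewrite Nl1E l1j oppr0.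
  split=> [i|]; last by rewrite Nl1E oppr_gt0.
  rewrite leNgt; apply/negP => li.
  by apply: (rot Nl1) => //; [rewrite Nl1E oppr_ge0 ltW|exists i].
- have : l1 w = 0; last by move/eqP; rewrite l1w oner_eq0.
  apply: Sind => // i; apply/eqP; rewrite eq_le !leNgt; apply/andP; split; apply/negP => li.
    by apply: (rot l1) => //; [rewrite l1u|exists i].
  apply: (rot Nl1) => //; [by rewrite Nl1E l1u oppr0|].
  by exists i; rewrite Nl1E oppr_gt0.
Qed.

End Functionals.

(** * Convex hulls *)

Section ConvexHulls.
Variables (R : realType) (V : vectType R).
Implicit Types (A P F G : set V) (u v w x y : V).

Lemma convex_setP A : convex_set A <-> forall x y (t : R),
  A x -> A y -> 0 <= t -> t <= 1 -> A (t *: x + (1 - t) *: y).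
Proof.
split=> [cA x y t Ax Ay t0 t1|cA].
  by have := cA x y (Itv01 t0 t1) (mem_set Ax) (mem_set Ay); rewrite inE.
move=> x y t; rewrite !inE => Ax Ay.
exact: cA.
Qed.

Lemma convex_comb A n (x : 'I_n -> V) (t : 'I_n -> R) : convex_set A ->
  (forall i, A (x i)) -> (forall i, 0 <= t i) -> \sum_i t i = 1 ->
  A (\sum_i t i *: x i).
Proof.
move=> cA; elim: n x t => [|n IH] x t Ax t0.
  by rewrite big_ord0 => /esym/eqP; rewrite oner_eq0.
rewrite !big_ord_recl => t1.
have s0 : 0 <= \sum_(i < n) t (lift ord0 i) by exact: sumr_ge0.
have [tE|tN] := eqVneq (t ord0) 1.
  rewrite big1 ?addr0 ?tE ?scale1r// => i _.
  have /eqP : \sum_(i < n) t (lift ord0 i) = 0 by lra.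
  by rewrite psumr_eq0// => /allP/(_ i (mem_index_enum i))/= /eqP ->; rewrite scale0r.
have tl1 : 0 < 1 - t ord0.
  by rewrite subr_gt0 lt_neqAle tN/= -t1 lerDl.
have -> : \sum_(i < n) t (lift ord0 i) *: x (lift ord0 i) = (1 - t ord0) *:
    \sum_(i < n) (t (lift ord0 i) / (1 - t ord0)) *: x (lift ord0 i).
  rewrite scaler_sumr; apply: eq_bigr => i _.
  by rewrite scalerA mulrC divfK// gt_eqF.
move/convex_setP : cA; apply => //; last by rewrite -t1 lerDl.
apply: IH => //; first by move=> i; rewrite divr_ge0// ltW.
have sE : \sum_(i < n) t (lift ord0 i) = 1 - t ord0 by lra.
by rewrite -mulr_suml sE divff// gt_eqF.
Qed.

Lemma convex_hull_range n (a : 'I_n -> V) x :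
  convex_hull (range a) x <-> exists t : 'I_n -> R,
    [/\ forall i, 0 <= t i, \sum_i t i = 1 & x = \sum_i t i *: a i].
Proof.
split=> [[k [y [s [ya s0 s1 ->]]]]|[t [t0 t1 ->]]]; last first.
  by exists n, a, t; split.
have /choice[j jE] : forall i, exists j, a j = y i.
  by move=> i; have [j _ ?] := ya i; exists j.
exists (fun h => \sum_(i | j i == h) s i); split.
- by move=> h; apply: sumr_ge0.
- by rewrite -s1 (partition_big j xpredT).
- rewrite (partition_big j xpredT)//=; apply: eq_bigr => h _.
  by rewrite scaler_suml; apply: eq_bigr => i /eqP <-; rewrite jE.
Qed.

Lemma sub_convex_hull A : A `<=` convex_hull A.
Proof.
move=> x Ax; exists 1%N, (fun=> x), (fun=> 1); split=> //.
- by rewrite big_ord1.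
- by rewrite big_ord1 scale1r.
Qed.

Lemma convex_hull_min A P : convex_set P -> A `<=` P -> convex_hull A `<=` P.
Proof.
move=> cP AP x [k [y [t [Ay t0 t1 ->]]]].
by apply: convex_comb => // i; exact: AP.
Qed.

Lemma convex_hull_convex A : convex_set (convex_hull A).
Proof.
apply/convex_setP => x y c [k1 [x1 [t1 [A1 p1 s1 ->]]]] [k2 [x2 [t2 [A2 p2 s2 ->]]]] c0 c1.
exists (k1 + k2)%N, (fun i => match fintype.split i with inl j => x1 j | inr j => x2 j end),
  (fun i => match fintype.split i with inl j => c * t1 j | inr j => (1 - c) * t2 j end).
split.
- by move=> i; case: (fintype.split i).
- by move=> i; case: (fintype.split i) => j; rewrite mulr_ge0// subr_ge0.
- rewrite big_split_ord/=.
  under eq_bigr do rewrite (unsplitK (inl _)).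
  under [X in _ + X]eq_bigr do rewrite (unsplitK (inr _)).
  by rewrite -!mulr_sumr s1 s2; ring.
- rewrite big_split_ord/=.
  under [X in _ = X + _]eq_bigr do rewrite (unsplitK (inl _)) -scalerA.
  under [X in _ = _ + X]eq_bigr do rewrite (unsplitK (inr _)) -scalerA.
  by rewrite -!scaler_sumr.
Qed.

Lemma polytope_range P : polytope P ->
  exists n (a : 'I_n -> V), P = convex_hull (range a).
Proof.
move=> [A /finite_seqP[s ->] ->].
exists (size s), (tnth (in_tuple s)); congr convex_hull.
apply/seteqP; split=> [x /= xs|x [i _ <-]]; last exact: mem_tnth.
have /tnthP[i ->] : x \in in_tuple s by [].
by exists i.
Qed.

Lemma range_polytope n (a : 'I_n -> V) : polytope (convex_hull (range a)).
Proof. by exists (range a) => //; exact: finite_image. Qed.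

(** Gordan's alternative for the vectors [a i - y], obtained from Farkas' lemma
    in the product with the line, where the second coordinate counts weights. *)
Lemma polytope_separation n (a : 'I_n -> V) y : ~ convex_hull (range a) y ->
  exists l : {scalar V}, forall i, l (a i) < l y.
Proof.
move=> ny.
pose b (i : 'I_n) : V * R^o := (a i - y, 1).
have /existsNP[L /not_implyP[Lb /negP]] : ~ forall L : {scalar (V * R^o)%type},
    (forall i, L (b i) <= 0) -> L (0, 1) <= 0.
  move=> /farkas_fam[t [t0 tE]]; apply: ny; apply/convex_hull_range; exists t.
  have t1 : \sum_i t i = 1.
    have /= := congr1 snd tE; rewrite raddf_sum/= => ->.
    by apply: eq_bigr => i _; rewrite /= /GRing.scale/= mulr1.
  split=> //; have /= := congr1 fst tE; rewrite raddf_sum/= => /esym.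
  under eq_bigr do rewrite scalerBr.
  by rewrite sumrB -scaler_suml t1 scale1r => /eqP; rewrite subr_eq0 => /eqP.
rewrite -ltNge => L1.
have [|l lE] := @functional_of R V (fun x => L (x, 0)).
  move=> c x z; rewrite -linearP; congr (L _).
  by congr pair; rewrite /= scaler0 addr0.
exists l => i; rewrite -subr_lt0 -linearB lE.
have -> : (a i - y, 0) = b i - (0, 1) :> (V * R^o)%type.
  by congr pair; rewrite /= ?subr0 ?subrr.
by rewrite linearB/= subr_lt0; exact: le_lt_trans (Lb i) L1.
Qed.

Lemma cone_move n (a : 'I_n -> V) v (t : 'I_n -> R) :
  convex_hull (range a) v -> (forall i, 0 <= t i) ->
  exists2 e : R, 0 < e & convex_hull (range a) (v + e *: \sum_i t i *: (a i - v)).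
Proof.
move=> Pv t0; set T := \sum_i t i.
have T0 : 0 <= T by exact: sumr_ge0.
have vE : \sum_i t i *: (a i - v) = \sum_i t i *: a i - T *: v.
  by under eq_bigr do rewrite scalerBr; rewrite sumrB -scaler_suml.
have [TE|TN] := eqVneq T 0.
  exists 1 => //; rewrite big1 ?scaler0 ?addr0// => i _.
  move/eqP: TE; rewrite psumr_eq0// => /allP/(_ i (mem_index_enum i)) /eqP ->.
  by rewrite scale0r.
have {}T0 : 0 < T by rewrite lt_neqAle eq_sym TN.
exists T^-1; first by rewrite invr_gt0.
rewrite vE scalerBr scalerA mulVf// scale1r addrC subrK.
apply/convex_hull_range; exists (fun i => t i / T); split.
- by move=> i; rewrite divr_ge0// ltW.
- by rewrite -mulr_suml divff.
- by rewrite scaler_sumr; apply: eq_bigr => i _; rewrite scalerA mulrC.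
Qed.

Lemma convex_move A x u (e s : R) : convex_set A -> A x -> A (x + e *: u) ->
  0 < e -> 0 <= s -> s <= e -> A (x + s *: u).
Proof.
move=> /convex_setP cA Ax Ae e0 s0 se.
have -> : x + s *: u = (s / e) *: (x + e *: u) + (1 - s / e) *: x.
  rewrite scalerDr scalerA divfK ?gt_eqF// scalerBl scale1r.
  by rewrite [RHS]addrC addrA subrK.
by apply: cA => //; [rewrite divr_ge0// ltW|rewrite ler_pdivrMr// mul1r].
Qed.

End ConvexHulls.

(** * Affine hulls and directions *)

Section Directions.
Variables (R : realType) (V : vectType R).
Implicit Types (A P F G : set V) (u v w x y : V) (l : {scalar V}).

Lemma affine_hull_nonempty A x : affine_hull A x -> A !=set0.
Proof.
move=> [[|k] [y [t [Ay t1 _]]]]; last by exists (y ord0).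
by move: t1; rewrite big_ord0 => /esym/eqP; rewrite oner_eq0.
Qed.

Lemma mem_direction A x y : affine_hull A x -> affine_hull A y ->
  y - x \in direction A.
Proof.
move=> Ax Ay; apply/(directionP _ (affine_hull_nonempty Ax)).
by exists x, y.
Qed.

Lemma mem_direction_sub A x y : A x -> A y -> y - x \in direction A.
Proof. by move=> Ax Ay; apply: mem_direction; exact: sub_affine_hull. Qed.

Lemma direction_min A v (U : {vspace V}) :
  A v -> (forall x, A x -> x - v \in U) -> (direction A <= U)%VS.
Proof.
move=> Av AU.
have aU x : affine_hull A x -> x - v \in U.
  move=> [k [y [t [Ay t1 ->]]]].
  rewrite -[v]scale1r -t1 scaler_suml -sumrB memv_suml// => i _.
  by rewrite -scalerBr memvZ// AU.
apply/subvP => d /directionP[|x [y [Ax Ay ->]]]; first by exists v.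
have -> : y - x = (y - v) - (x - v) by rewrite opprB addrA subrK.
by rewrite memvB// aU.
Qed.

Lemma affine_hull_direction A v u :
  affine_hull A v -> u \in direction A -> affine_hull A (v + u).
Proof.
move=> Av /directionP[|x [y [Ax Ay ->]]]; first exact: affine_hull_nonempty Av.
by rewrite -[y - x]scale1r; exact: affine_hull_comb.
Qed.

Lemma adimE A : A !=set0 -> adim A = (\dim (direction A))%:Z.
Proof.
move=> [x Ax]; rewrite /adim; case: asboolP => // A0.
by rewrite A0 in Ax.
Qed.

Lemma functional_direction A l (c : R) u : A !=set0 ->
  (forall x, A x -> l x = c) -> u \in direction A -> l u = 0.
Proof.
move=> A0 lA /(directionP _ A0)[_ [_ [[k1 [x [t [Ax t1 ->]]]] [k2 [y [s [Ay s1 ->]]]] ->]]].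
have lc k (z : 'I_k -> V) (r : 'I_k -> R) : (forall i, A (z i)) ->
    \sum_i r i = 1 -> l (\sum_i r i *: z i) = c.
  move=> Az r1; rewrite linear_sum -[c]mul1r -r1 mulr_suml; apply: eq_bigr => i _.
  by rewrite linearZ/= lA.
by rewrite linearB !lc ?subrr.
Qed.

Lemma mem_span_enum (J : finType) (b : J -> V) j : b j \in <<[seq b i | i <- enum J]>>%VS.
Proof. by rewrite memv_span// map_f// mem_enum. Qed.

Lemma direction_range n (a : 'I_n -> V) v : convex_hull (range a) v ->
  direction (convex_hull (range a)) = <<[seq a i - v | i <- enum 'I_n]>>%VS.
Proof.
move=> Pv; apply/eqP; rewrite eqEsubv; apply/andP; split.
  apply: direction_min Pv _ => x /convex_hull_range[t [_ t1 ->]].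
  rewrite -{1}[v]scale1r -t1 scaler_suml -sumrB memv_suml// => i _.
  by rewrite -scalerBr memvZ// (mem_span_enum (fun i => a i - v)).
apply/span_subvP => x /mapP[i _ ->]; apply: mem_direction_sub => //.
exact: sub_convex_hull.
Qed.

End Directions.

(** * Faces of polytopes *)

Section Faces.
Variables (R : realType) (V : vectType R).
Implicit Types (A P F G : set V) (u v w x y : V) (l : {scalar V}).

Lemma face_sub P F : face P F -> F `<=` P.
Proof. by move=> [l [c [_ ->]]] x []. Qed.

(** The weighted defects [t i * (c - l (x i))] are nonnegative and sum to zero. *)
Lemma face_weights n (x : 'I_n -> V) (t : 'I_n -> R) P F :
  face P F -> (forall i, P (x i)) -> (forall i, 0 <= t i) -> \sum_i t i = 1 ->
  F (\sum_i t i *: x i) -> forall i, 0 < t i -> F (x i).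
Proof.
move=> [l [c [lc ->]]] Px t0 t1 [_ lF] i ti; split=> //.
apply/eqP; rewrite eq_le lc//= leNgt; apply/negP => li.
have : \sum_i t i * (c - l (x i)) = 0.
  under eq_bigr do rewrite mulrBr.
  rewrite sumrB -mulr_suml t1 mul1r -lF linear_sum.
  by apply/eqP; rewrite subr_eq0; apply/eqP/eq_bigr => j _; rewrite linearZ.
move=> /eqP; rewrite psumr_eq0 => [/allP/(_ i (mem_index_enum i))|j _].
  by rewrite /= mulf_eq0 subr_eq0 !gt_eqF.
by rewrite mulr_ge0// subr_ge0 lc.
Qed.

Lemma face_convex P F x y (t : R) : face P F -> P x -> P y -> 0 < t -> t < 1 ->
  F (t *: x + (1 - t) *: y) -> F x /\ F y.
Proof.
move=> fF Px Py t0 t1 Fz.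
have := @face_weights 2 (fun i => if i == 0 then x else y)
  (fun i => if i == 0 then t else 1 - t) P F fF.
rewrite !big_ord_recl !big_ord0/= !addr0 => H; split.
  by apply: (H _ _ _ _ ord0) => //; [move=> i; case: ifP|
    move=> i; case: ifP => _; rewrite ?subr_ge0 ltW|lra].
by apply: (H _ _ _ _ ord_max) => /=; [move=> i; case: ifP|
    move=> i; case: ifP => _; rewrite ?subr_ge0 ltW|lra| |rewrite subr_gt0].
Qed.

Lemma positive_weight n (t : 'I_n -> R) : (forall i, 0 <= t i) -> \sum_i t i = 1 ->
  exists i, 0 < t i.
Proof.
move=> t0 t1; apply: contrapT => /forallNP nt; move: t1; rewrite big1.
  by move=> /esym/eqP; rewrite oner_eq0.
by move=> i _; apply/eqP; rewrite eq_le t0 andbT leNgt; apply/negP/nt.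
Qed.

Lemma face_convex_set P F : convex_set P -> face P F -> convex_set F.
Proof.
move=> /convex_setP cP [l [c [_ ->]]]; apply/convex_setP => x y t [Px lx] [Py ly] t0 t1.
by split; [exact: cP|rewrite linearD !linearZ/= lx ly; ring].
Qed.

Lemma face_range n (a : 'I_n -> V) F : face (convex_hull (range a)) F ->
  F = convex_hull (a @` [set i | F (a i)]).
Proof.
move=> fF; apply/seteqP; split=> [y Fy|]; last first.
  apply: convex_hull_min => [|_ [i Fi <-]//].
  exact: face_convex_set (@convex_hull_convex _ _ _) fF.
have /convex_hull_range[t [t0 t1 yE]] := face_sub fF Fy.
have Fa i : 0 < t i -> F (a i).
  apply: (face_weights fF _ t0 t1); rewrite -?yE// => j.
  by apply: sub_convex_hull; exists j.
have [i0 ti0] := positive_weight t0 t1.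
exists n, (fun i => if 0 < t i then a i else a i0), t; split=> //.
  by move=> i; case: ifP => ti; [exists i|exists i0] => //; exact: Fa.
rewrite yE; apply: eq_bigr => i _; case: ifP => // /negbT; rewrite -leNgt => ti.
have /eqP -> : t i == 0 by rewrite eq_le ti t0.
by rewrite !scale0r.
Qed.

Lemma vertex_mem P v : vertex P v -> P v.
Proof. by move=> /face_sub; apply. Qed.

Lemma vertex_weights n (x : 'I_n -> V) (t : 'I_n -> R) P v :
  vertex P v -> (forall i, P (x i)) -> (forall i, 0 <= t i) -> \sum_i t i = 1 ->
  v = \sum_i t i *: x i -> exists i, v = x i.
Proof.
move=> Pv Px t0 t1 vE; have [i ti] := positive_weight t0 t1.
by exists i; apply/esym/(face_weights Pv Px t0 t1 _ ti); rewrite -vE.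
Qed.

Lemma vertex_separated n (a : 'I_n -> V) v (l : {scalar V}) :
  convex_hull (range a) v -> (forall i, a i = v \/ l (a i) < l v) ->
  vertex (convex_hull (range a)) v.
Proof.
move=> Pv al.
have lle x : convex_hull (range a) x -> l x <= l v /\ (l x = l v -> x = v).
  move=> /convex_hull_range[t [t0 t1 ->]].
  have le i : t i * l (a i) <= t i * l v.
    by apply: ler_wpM2l => //; have [->//|/ltW] := al i.
  have lv : l v = \sum_i t i * l v by rewrite -mulr_suml t1 mul1r.
  rewrite linear_sum; under eq_bigr do rewrite linearZ/=.
  split=> [|lE]; first by rewrite [leRHS]lv; exact: ler_sum.
  rewrite -[RHS]scale1r -t1 scaler_suml; apply: eq_bigr => i _.
  have [->//|lti] := al i.
  suff -> : t i = 0 by rewrite !scale0r.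
  apply/eqP/negPn/negP => ti0.
  have : \sum_i (t i * l v - t i * l (a i)) = 0 by rewrite sumrB lE -lv subrr.
  move=> /eqP; rewrite psumr_eq0 => [/allP/(_ i (mem_index_enum i))|j _].
    by rewrite /= -mulrBr mulf_eq0 (negPf ti0) subr_eq0 gt_eqF.
  by rewrite subr_ge0.
exists l, (l v); split; first by move=> x /lle[].
by apply/seteqP; split=> [x ->|x [/lle[_ +]]]; [split|exact].
Qed.

(** In a generating family of minimal length, each member is separated from the
    convex hull of the others, so it is a vertex. *)
Lemma polytope_vertices P : polytope P ->
  exists n (a : 'I_n -> V), [/\ injective a, P = convex_hull (range a) &
    forall v, vertex P v <-> exists i, v = a i].
Proof.
move=> /polytope_range[n0 [a0 PE0]].
pose Q n := `[< exists a : 'I_n -> V, P = convex_hull (range a) >].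
have Qn0 : Q n0 by apply/asboolP; exists a0.
have [n /asboolP[a PE] nmin] := ex_minnP (ex_intro _ n0 Qn0).
have sep i : exists l : {scalar V}, forall j, j != i -> l (a j) < l (a i).
  case: n => [|n] in a PE nmin i *; first by case: i.
  have nai : ~ convex_hull (range (fun j => a (lift i j))) (a i).
    move=> ai; suff /nmin : Q n by rewrite ltnn.
    apply/asboolP; exists (fun j => a (lift i j)); rewrite PE; apply/seteqP; split.
      apply: convex_hull_min; first exact: convex_hull_convex.
      move=> _ [j _ <-]; have [k ->|->//] := unliftP i j.
      by apply: sub_convex_hull; exists k.
    apply: convex_hull_min; first exact: convex_hull_convex.
    by move=> _ [j _ <-]; apply: sub_convex_hull; exists (lift i j).
  have [l ll] := polytope_separation nai.
  by exists l => j; have [k -> _|->] := unliftP i j; rewrite ?eqxx.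
exists n, a; split=> //.
- move=> i j aij; apply/eqP/negPn/negP => ij.
  by have [l /(_ i ij)] := sep j; rewrite aij ltxx.
- move=> v; split=> [vP|[i ->]].
    have := vertex_mem vP; rewrite {1}PE => /convex_hull_range[t [t0 t1 vE]].
    apply: (vertex_weights vP _ t0 t1 vE) => i.
    by rewrite PE; apply: sub_convex_hull; exists i.
  rewrite PE; have [l ll] := sep i.
  apply: (@vertex_separated _ _ _ l); first by apply: sub_convex_hull; exists i.
  by move=> j; have [->|/ll] := eqVneq j i; [left|right].
Qed.

Lemma direction_face n (a : 'I_n -> V) P v l : P = convex_hull (range a) -> P v ->
  (forall x, P x -> l x <= l v) ->
  direction [set x | P x /\ l x = l v] = zero_span (fun i => a i - v) l.
Proof.
move=> PE Pv lv; set F := [set _ | _].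
have fF : face P F by exists l, (l v).
have Pa i : P (a i) by rewrite PE; apply: sub_convex_hull; exists i.
have Fv : F v by [].
apply/eqP; rewrite eqEsubv; apply/andP; split; last first.
  apply: zero_span_sub => i /eqP; rewrite linearB subr_eq0 => /eqP li.
  exact: mem_direction_sub.
apply: (direction_min Fv) => x Fx.
have := Fx.1; rewrite {1}PE => /convex_hull_range[t [t0 t1 xE]].
rewrite xE -{1}[v]scale1r -t1 scaler_suml -sumrB memv_suml// => i _.
have [->|ti] := eqVneq (t i) 0; first by rewrite !scale0r subrr mem0v.
rewrite -scalerBr memvZ// mem_zero_span// linearB/=.
have [] : F (a i); last by move=> _ ->; rewrite subrr.
by apply: (face_weights fF Pa t0 t1); rewrite -?xE// lt_neqAle eq_sym ti t0.
Qed.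

(** The facet lemma for cones, read at a point [v] of a polytope.  The family [b]
    generates the cone of directions from [v] into [P], enlarged perhaps by the
    opposites of some of its generators.  Without opposites this says that
    near [v] the polytope is cut out by its facets through [v]; an opposite
    [v - a i] forces the facet to pass through [a i]. *)
Lemma facet_separation n (a : 'I_n -> V) P v (J : finType) (b : J -> V) u :
  P = convex_hull (range a) -> P v ->
  (forall i, exists j, b j = a i - v) ->
  (forall j, exists i, b j = a i - v \/ b j = v - a i \/ b j = 0) ->
  u \in direction P ->
  ~ (exists t : J -> R, (forall j, 0 <= t j) /\ u = \sum_j t j *: b j) ->
  exists l : {scalar V}, [/\ forall j, l (b j) <= 0, 0 < l u,
    forall x, P x -> l x <= l v & facet P [set x | P x /\ l x = l v]].
Proof.
move=> PE Pv ab ba uP ncone.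
have bE : <<[seq b j | j <- enum J]>>%VS = direction P.
  rewrite PE (direction_range (v := v)) -?PE//; apply/eqP; rewrite eqEsubv.
  apply/andP; split; apply/span_subvP => x /mapP[i _ ->].
    have [j [->|[->|->]]] := ba i; rewrite ?mem0v//.
      exact: (mem_span_enum (fun i => a i - v)).
    by rewrite -opprB memvN (mem_span_enum (fun i => a i - v)).
  by have [j <-] := ab i; exact: mem_span_enum.
have [|l [lb lu ld]] := cone_facet _ ncone; first by rewrite bE.
have lv x : P x -> l x <= l v.
  rewrite PE => /convex_hull_range[t [t0 t1 ->]].
  rewrite -[v]scale1r -t1 scaler_suml !linear_sum ler_sum// => i _.
  rewrite !linearZ/= ler_wpM2l//.
  by have [j jE] := ab i; have := lb j; rewrite jE linearB subr_le0.
exists l; split=> //; split; first by exists l, (l v).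
rewrite !adimE; [|by exists v..].
rewrite -bE -ld (direction_face PE)//.
suff -> : zero_span (fun i => a i - v) l = zero_span b l by rewrite -addn1 PoszD addrK.
apply/eqP; rewrite eqEsubv; apply/andP; split; apply: zero_span_sub => i.
  by have [j <-] := ab i => lj; exact: mem_zero_span.
have [j [->|[->|->]]] := ba i => lj; rewrite ?mem0v//; last first.
  rewrite -opprB memvN; apply: (mem_zero_span (a := fun i => a i - v)).
  by rewrite -opprB linearN/= lj oppr0.
by apply: (mem_zero_span (a := fun i => a i - v)).
Qed.

(** Take [q] in [P] outside [F].  The direction [v - q] does not belong to the
    cone at [v] enlarged by the opposites of the directions into [F]; the facet
    that separates it contains [F] and misses [q]. *)
Lemma proper_face_facet P F v : polytope P -> proper_face P F -> F v ->
  exists l : {scalar V}, [/\ forall x, P x -> l x <= l v,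
    facet P [set x | P x /\ l x = l v] & F `<=` [set x | P x /\ l x = l v]].
Proof.
move=> /polytope_range[n [a PE]] [[l0 [c [l0c FE]]] FP] Fv.
have [Pv l0v] : P v /\ l0 v = c by rewrite FE in Fv.
have Pa i : P (a i) by rewrite PE; apply: sub_convex_hull; exists i.
have [q [Pq l0q]] : exists q, P q /\ l0 q < c.
  apply: contrapT => nq; apply: FP; rewrite FE; apply/seteqP; split=> [x []//|x Px].
  split=> //; apply/eqP; rewrite eq_le l0c//= leNgt.
  by apply/negP => xc; apply: nq; exists x.
pose b (j : bool * 'I_n) := if j.1 then a j.2 - v else
  if l0 (a j.2) == c then v - a j.2 else 0.
have [||||l [lb lu lv lF]] := @facet_separation n a P v _ b (v - q) PE Pv.
- by move=> i; exists (true, i).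
- move=> [[] i]; exists i; rewrite /b/=; first by left.
  by case: ifP => _; right; [left|right].
- exact: mem_direction_sub.
- move=> [t [t0 /(congr1 l0)]]; rewrite linearB/= linear_sum => lE.
  have : l0 v - l0 q <= 0.
    rewrite lE; apply: sumr_le0 => -[e i] _; rewrite linearZ/= mulr_ge0_le0//.
    rewrite /b; case: e => /=; first by rewrite linearB subr_le0 l0v l0c.
    by case: eqP => [li|_]; rewrite ?linear0// linearB/= li l0v subrr.
  by rewrite leNgt subr_gt0 l0v l0q.
exists l; split=> // x Fx; split; first by move: Fx; rewrite FE => -[].
have Px : P x by move: Fx; rewrite FE => -[].
have := Px; rewrite {1}PE => /convex_hull_range[t [t0 t1 xE]].
rewrite xE -[v]scale1r -t1 scaler_suml !linear_sum; apply: eq_bigr => i _.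
have [->|ti] := eqVneq (t i) 0; first by rewrite !scale0r !linear0.
rewrite !linearZ/=; congr (_ * _).
have Fai : F (a i).
  by apply: (face_weights (t := t) _ Pa) => //; [exists l0, c|rewrite -xE|
    rewrite lt_neqAle eq_sym ti t0].
have lai : l0 (a i) = c by move: Fai; rewrite FE => -[].
apply/eqP; rewrite eq_le lv//=.
by have := lb (false, i); rewrite /b/= lai eqxx linearB subr_le0.
Qed.

End Faces.

(** * Affine maps as linear maps followed by translations *)

Section AffineMaps.
Variables (R : realType) (V W : vectType R).

Lemma linear_of (h : V -> W) :
  (forall a u v, h (a *: u + v) = a *: h u + h v) ->
  exists L : {linear V -> W}, forall x, L x = h x.
Proof.
move=> hl.
pose H := GRing.isLinear.Build R V W *:%R h hl.
pose L : {linear V -> W} := HB.pack h H.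
by exists L.
Qed.

(** The domain need not be convex: write its points as affine combinations of
    a maximal affinely independent family of them.  A last coordinate equal to 1
    turns affine independence into freeness, and the coordinates in the family
    are then linear. *)
Lemma affine_map_extension (A : set V) (g : A -> W) : affine_map g ->
  exists (L : {linear V -> W}) (b : W), forall x : A, g x = L (set_val x) + b.
Proof.
move=> gA.
pose h (x : A) : (V * R^o)%type := (set_val x, 1).
pose Q r := `[< exists s : seq A, size s = r /\ free (map h s) >].
have Q0 : exists r, Q r by exists 0%N; apply/asboolP; exists [::]; rewrite nil_free.
have Qb r : Q r -> (r <= \dim {:(V * R^o)%type})%N.
  move=> /asboolP[s [<- /eqP fs]]; rewrite -(size_map h) -fs.
  exact/dimvS/subvf.
have [r /asboolP[s [sr fs]] rmax] := ex_maxnP Q0 Qb.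
pose X := map_tuple h (in_tuple s).
have hX y : h y \in <<X>>%VS.
  apply/negPn/negP => hy; suff /rmax : Q r.+1 by rewrite ltnn.
  by apply/asboolP; exists (y :: s); rewrite /= sr free_cons hy fs.
have Xi (i : 'I_(size s)) : X`_i = h (tnth (in_tuple s) i).
  by rewrite -tnth_nth tnth_map.
have gE y : g y = \sum_i coord X i (h y) *: g (tnth (in_tuple s) i).
  have hE := coord_span (hX y); apply: gA.
    have /= := congr1 snd hE; rewrite raddf_sum/= => ->.
    by apply: eq_bigr => i _; rewrite Xi /= /GRing.scale/= mulr1.
  have /= := congr1 fst hE; rewrite raddf_sum/= => {1}->.
  by apply: eq_bigr => i _; rewrite Xi.
have [|L LE] := linear_of
    (h := fun x => \sum_i coord X i (x, 0) *: g (tnth (in_tuple s) i)).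
  move=> a u v; rewrite scaler_sumr -big_split; apply: eq_bigr => i _ /=.
  rewrite scalerA -scalerDl -linearP; congr (coord _ _ _ *: _).
  by congr pair; rewrite /= scaler0 addr0.
exists L, (\sum_i coord X i (0, 1) *: g (tnth (in_tuple s) i)) => y.
rewrite gE LE -big_split; apply: eq_bigr => i _ /=.
rewrite -scalerDl -linearD; congr (coord _ _ _ *: _).
by congr pair; rewrite /= ?addr0 ?add0r.
Qed.

Lemma affine_map_restriction (A : set V) (L : {linear V -> W}) b :
  affine_map (fun x : A => L (set_val x) + b).
Proof.
move=> k x t y t1 ->; rewrite linear_sum.
under [RHS]eq_bigr do rewrite scalerDr.
rewrite big_split/= -scaler_suml t1 scale1r; congr (_ + _).
by apply: eq_bigr => i _; rewrite linearZ.
Qed.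

Lemma affine_sum (L : {linear V -> W}) b n (x : 'I_n -> V) (t : 'I_n -> R) :
  \sum_i t i = 1 -> L (\sum_i t i *: x i) + b = \sum_i t i *: (L (x i) + b).
Proof.
move=> t1; under [RHS]eq_bigr do rewrite scalerDr.
rewrite big_split/= -scaler_suml t1 scale1r linear_sum; congr (_ + _).
by apply: eq_bigr => i _; rewrite linearZ.
Qed.

End AffineMaps.

(** * Relative interiors and boundaries *)

Lemma cvg_lincomb (R : realType) (W : normedModType R) (T : Type)
    (F : set_system T) {FF : Filter F} (I : Type) (r : seq I)
    (f : I -> T -> R) (a : I -> R) (h : I -> T -> W) (c : I -> W) :
  (forall i, f i y @[y --> F] --> a i) -> (forall i, h i y @[y --> F] --> c i) ->
  \sum_(i <- r) f i y *: h i y @[y --> F] --> \sum_(i <- r) a i *: c i.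
Proof.
move=> fa hc; elim: r => [|j r IH].
  under eq_cvg do rewrite big_nil.
  by rewrite big_nil; exact: cvg_cst.
under eq_cvg do rewrite big_cons.
by rewrite big_cons; apply: cvgD => //; exact: cvgZ.
Qed.

Lemma linear_rV_continuous (R : realType) (k : nat) (W : normedModType R)
  (L : 'rV[R]_k -> W) : linear L -> continuous L.
Proof.
move=> Llin x.
pose H := GRing.isLinear.Build R 'rV[R]_k W *:%R L Llin.
pose L' : {linear 'rV[R]_k -> W} := HB.pack L H.
have LE : L = (fun y : 'rV[R]_k => \sum_j y 0 j *: L' (delta_mx 0 j)).
  by apply/funext => y; rewrite -[L y]/(L' y) {1}[y]row_sum_delta linear_sum;
    apply: eq_bigr => j _; rewrite linearZ.
rewrite LE; apply: (@cvg_lincomb R W _ (nbhs x) _) => j; first exact: coord_continuous.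
exact: (@cvg_cst _ _ _ (nbhs x) _).
Qed.

Section RelativeInterior.
Variables (R : realType) (k : nat).
Local Notation V := 'rV[R]_k.
Implicit Types (A P F : set V) (u v w x y : V) (l : {scalar V}).

Lemma functional_continuous l : continuous l.
Proof. by apply: (@linear_rV_continuous R k R^o) => a u v; rewrite linearP. Qed.

Lemma functional_gt_near l x (c : R) : c < l x -> \forall y \near x, c < l y.
Proof. by move=> cl; apply: (cvgr_gt _ (@functional_continuous l x)). Qed.

Lemma segment_cvg x u (t0 : R) : x + t *: u @[t --> t0] --> x + t0 *: u.
Proof. by apply: cvgD; [exact: cvg_cst|apply: cvgZr_tmp; exact: cvg_id]. Qed.

Lemma relint_move A x u : relint A x -> u \in direction A ->
  exists2 e : R, 0 < e & forall t, `|t| <= e -> A (x + t *: u).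
Proof.
move=> [Ax nx] uA.
have : \forall t \near (0 : R), A (x + t *: u).
  have H : x + t *: u @[t --> (0 : R)] --> x.
    by have := @segment_cvg x u 0; rewrite scale0r addr0.
  have : \forall t \near (0 : R), affine_hull A (x + t *: u) -> A (x + t *: u).
    exact: H _ nx.
  apply: filterS => t; apply.
  by apply: affine_hull_direction; [exact: sub_affine_hull|exact: memvZ].
move=> /nbhs_ballP[e /= e0 He]; exists (e / 2); first by rewrite divr_gt0.
move=> t te; apply: He; rewrite /ball/= sub0r normrN.
by apply: le_lt_trans te _; rewrite ltr_pdivrMr// ltr_pMr// ltr1n.
Qed.

Lemma relint_near A x : relint A x ->
  \forall y \near x, affine_hull A y -> relint A y.
Proof.
move=> [_ nx].
have : \forall y \near x, \forall z \near y, affine_hull A z -> A z.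
  exact: near_join nx.
apply: filterS => y ny hy; split => //.
by have /nbhs_singleton := ny; exact.
Qed.

(** The homothety [h] with centre [y] that sends [x + s *: (y - x)] back to [x]
    is continuous and preserves the affine hull, so it sends the points near
    the former into [A]; each of them lies between [y] and its image. *)
Lemma relint_segment A x y (s : R) : convex_set A -> relint A x -> A y ->
  0 <= s -> s < 1 -> relint A (x + s *: (y - x)).
Proof.
move=> cA [Ax nx] Ay s0 s1.
have s1' : 1 - s != 0 by rewrite subr_eq0 eq_sym lt_eqF.
have cA' := (convex_setP A).1 cA.
split.
  have -> : x + s *: (y - x) = s *: y + (1 - s) *: x.
    by rewrite scalerBl scale1r scalerBr addrCA addrA.
  by apply: cA' => //; exact: ltW.
set z := x + _.
pose h w := (1 - s)^-1 *: (w - s *: y).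
have hz : h z = x.
  have -> : h z = (1 - s)^-1 *: ((1 - s) *: x).
    by congr (_ *: _); rewrite /z scalerBl scale1r scalerBr addrA addrAC [x + _]addrC addrK.
  by rewrite scalerA mulVf// scale1r.
have hc : h w @[w --> z] --> x.
  rewrite -hz; apply: (@cvgZl_tmp _ _ _ (nbhs z)).
  exact: (@cvgB _ _ _ (nbhs z) _ _ _ _ _ (@cvg_id _ _) (@cvg_cst _ _ _ _ _)).
have : \forall w \near z, affine_hull A (h w) -> A (h w) by exact: hc _ nx.
apply: filterS => w H hw.
have hwA : A (h w).
  apply: H; have -> : h w = w + (s / (1 - s)) *: (w - y).
    rewrite /h !scalerBr scalerA [_^-1 * s]mulrC addrA -{2}[w]scale1r -scalerDl.
    by congr (_ *: _ - _); field.
  by apply: affine_hull_comb => //; exact: sub_affine_hull.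
have -> : w = s *: y + (1 - s) *: h w.
  by rewrite /h scalerA divff// scale1r addrC subrK.
by apply: cA' => //; exact: ltW.
Qed.


(** The exit point is at the supremum of the parameters that stay in [A]. *)
Lemma segment_exit A x y : closed A -> A x -> affine_hull A y -> ~ A y ->
  exists t, [/\ 0 <= t, t < 1 & boundary A (x + t *: (y - x))].
Proof.
move=> clA Ax Ay nAy.
pose T := [set t : R | [/\ 0 <= t, t <= 1 & A (x + t *: (y - x))]].
have T0 : T 0 by split; rewrite ?ler01// scale0r addr0.
have T1 : ubound T 1 by move=> t [].
have Tsup : has_sup T by split; [exists 0|exists 1].
set s := sup T.
have s0 : 0 <= s by exact: sup_upper_bound T0.
have s1 : s <= 1 by apply: sup_le_ub => //; exists 0.
have As : A (x + s *: (y - x)).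
  apply: clA => B nB.
  have [t [[t0 t1 At] Bt]] : T `&` [set t | B (x + t *: (y - x))] !=set0.
    by apply: closure_sup; [exists 0|exists 1|exact: segment_cvg nB].
  by exists (x + t *: (y - x)).
have {}s1 : s < 1.
  rewrite lt_neqAle s1 andbT; apply/eqP => sE; apply: nAy.
  by move: As; rewrite sE scale1r addrC subrK.
exists s; split=> //; split=> // rs.
have [|e e0 He] := relint_move (u := y - x) rs.
  by apply: mem_direction => //; exact: sub_affine_hull.
pose d := Num.min e (1 - s).
have d0 : 0 < d by rewrite lt_min e0 subr_gt0.
have : T (s + d).
  split; first by rewrite addr_ge0// ltW.
    by rewrite -lerBrDl ge_min lexx orbT.
  rewrite scalerDl addrA; apply: He.
  by rewrite gtr0_norm// ge_min lexx.
move=> /(sup_upper_bound Tsup).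
by rewrite -/s gerDl leNgt d0.
Qed.

Lemma ray_exit A x u : compact A -> A x -> u \in direction A -> u != 0 ->
  exists2 t, 0 <= t & boundary A (x + t *: u).
Proof.
move=> cA Ax uA u0.
have [M [_ AM]] := compact_bounded cA.
have {}AM z : A z -> `|z| <= `|M| + 1.
  by apply: AM; rewrite (le_lt_trans (ler_norm _))// ltrDl.
have nu0 : 0 < `|u| by rewrite normr_gt0.
pose N := (`|M| + `|x| + 2) / `|u|.
have N0 : 0 <= N by rewrite divr_ge0// !addr_ge0.
have nAy : ~ A (x + N *: u).
  move=> /AM H.
  have : `|N *: u| <= `|M| + 1 + `|x|.
    rewrite -[N *: u](addKr x) (le_trans (ler_normD _ _))// normrN addrC lerD2r//.
  rewrite normrZ (ger0_norm N0) divfK ?gt_eqF//; lra.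
have [||t [t0 t1]] := segment_exit (compact_closed _ cA) Ax _ nAy.
- exact: norm_hausdorff.
- by apply: affine_hull_direction; [exact: sub_affine_hull|exact: memvZ].
rewrite addrAC subrr add0r scalerA => Bt.
by exists (t * N) => //; rewrite mulr_ge0.
Qed.

Lemma polytope_compact P : polytope P -> compact P.
Proof.
move=> /polytope_range[n [a ->]]; apply: bounded_closed_compact.
  exists (\sum_i `|a i|); split; first by rewrite num_real.
  move=> M ltM x /convex_hull_range[t [t0 t1 ->]].
  apply: le_trans (ltW ltM); apply: le_trans (ler_norm_sum _ _ _) _.
  apply: ler_sum => i _; rewrite normrZ ger0_norm// ler_piMl//.
  by rewrite -t1 (bigD1 i)//= lerDl sumr_ge0.
move=> x clx; apply: contrapT => /polytope_separation[l lx].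
have : \forall y \near x, forall i, l (a i) < l y.
  by apply: (@filter_forall _ _ _ (nbhs x)) => i; exact: functional_gt_near.
move=> /clx[y [/convex_hull_range[t [t0 t1 yE]] ly]].
have : \sum_i t i * (l y - l (a i)) = 0.
  under eq_bigr do rewrite mulrBr.
  rewrite sumrB -mulr_suml t1 mul1r {1}yE linear_sum.
  by apply/eqP; rewrite subr_eq0; apply/eqP/eq_bigr => i _; rewrite linearZ.
move=> /eqP; rewrite psumr_eq0 => [/allP H|i _]; last first.
  by rewrite mulr_ge0// subr_ge0 ltW.
move: t1; rewrite big1 => [/esym/eqP|i _]; first by rewrite oner_eq0.
have := H i (mem_index_enum i); rewrite mulf_eq0 subr_eq0 [l y == _]gt_eqF// orbF.
by move/eqP.
Qed.

(** A point of a polytope that lies on no proper face can be moved a little in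
    every direction, by Farkas' lemma, and hence in all directions at once, by
    convexity. *)
Lemma boundary_proper_face P x : polytope P -> boundary P x ->
  exists F, proper_face P F /\ F x.
Proof.
move=> /polytope_range[n [a PE]] [Px nrx]; apply: contrapT => nF.
have mv u : u \in direction P -> exists2 e : R, 0 < e & P (x + e *: u).
  move=> uP.
  suff [t [t0 ->]] : exists t : 'I_n -> R, (forall i, 0 <= t i) /\
      u = \sum_i t i *: (a i - x).
    by rewrite PE; apply: cone_move => //; rewrite -PE.
  apply: farkas_fam => l la; rewrite leNgt; apply/negP => lu; apply: nF.
  have lx y : P y -> l y <= l x.
    rewrite PE => /convex_hull_range[t [t0 t1 ->]].
    rewrite -[x]scale1r -t1 scaler_suml !linear_sum ler_sum// => i _.
    by rewrite !linearZ/= ler_wpM2l//; have := la i; rewrite linearB subr_le0.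
  exists [set y | P y /\ l y = l x]; split=> //; split; first by exists l, (l x).
  move=> FE; have : l u = 0.
    apply: (@functional_direction _ _ P l (l x)) => //; first by exists x.
    by move=> y; rewrite -{1}FE => -[].
  by move=> lu0; rewrite lu0 ltxx in lu.
have cP : convex_set P by rewrite PE; exact: convex_hull_convex.
apply: nrx; split=> //.
set D := direction P in mv; set p := \dim D.
pose e (i : 'I_p) : V := (vbasis D)`_i.
have eD i : e i \in D by apply: vbasis_mem; rewrite mem_nth// size_tuple.
have /choice[d dP] : forall i, exists d : R, 0 < d /\
    forall s, `|s| <= d -> P (x + s *: e i).
  move=> i; have [d1 d10 H1] := mv _ (eD i).
  have [|d2 d20 H2] := mv (- e i); first by rewrite memvN.
  exists (Num.min d1 d2); split; first by rewrite lt_min d10.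
  move=> s; rewrite le_min => /andP[s1 s2].
  have [s0|s0] := leP 0 s.
    by apply: (convex_move cP Px H1) => //; rewrite -(ger0_norm s0).
  rewrite -[s *: _]opprK -scalerN -scaleNr.
  by apply: (convex_move cP Px H2) => //; [rewrite oppr_ge0 ltW|rewrite -(ltr0_norm s0)].
have : \forall y \near x, forall i, `|p%:R * coord (vbasis D) i (y - x)| <= d i.
  apply: (@filter_forall _ _ _ (nbhs x)) => i.
  have [|l lE] := @functional_of R V (fun u => coord (vbasis D) i u).
    by move=> c u v; rewrite linearP.
  have [d0 _] := dP i; have p0 : 0 <= p%:R :> R by rewrite ler0n.
  have : \forall y \near x, - d i < p%:R * l (y - x) /\ p%:R * l (y - x) < d i.
    have [l1 l1E] := functional_comb l l p%:R 0.
    have [l2 l2E] := functional_comb l l (- p%:R) 0.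
    apply: (@filterS2 _ (nbhs x) _ _ _ _ _
      (@functional_gt_near l1 x (l1 x - d i) _) (@functional_gt_near l2 x (l2 x - d i) _)).
    - by move=> y; rewrite !l1E !l2E linearB; lra.
    - by rewrite gtrBl.
    - by rewrite gtrBl.
  by apply: filterS => y; rewrite lE => -[y1 y2]; rewrite ler_norml !ltW.
apply: filterS => y Hy hy.
have yD : y - x \in D by apply: mem_direction => //; exact: sub_affine_hull.
have yE := coord_vbasis yD.
have [p0|p0] := posnP p.
  have -> : y = x; last by [].
  apply/eqP; rewrite -subr_eq0 yE big1// => i _.
  have ip : (i < p)%N by exact: ltn_ord.
  by exfalso; rewrite p0 in ip.
have pn0 : (p%:R : R) != 0 by rewrite pnatr_eq0 -lt0n.
have -> : y = \sum_(i < p) p%:R^-1 *: (x + (p%:R * coord (vbasis D) i (y - x)) *: e i).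
  under eq_bigr do rewrite scalerDr scalerA mulrA mulVf// mul1r.
  rewrite big_split/= -yE sumr_const card_ord -scaler_nat scalerA divff// scale1r.
  by rewrite addrC subrK.
apply: convex_comb => //.
- by move=> i; have [_] := dP i; apply.
- by rewrite sumr_const card_ord -[_ *+ p]mulr_natr mulVf.
Qed.

End RelativeInterior.

(** * Sandwiching and complementing maps *)

Section SandwichComplementTheory.
Variable R : realType.

Definition point_of (T : Type) (A : set T) x (Ax : A x) : A := SigSub (mem_set Ax).

Lemma affine_hull_same_dim (V : vectType R) (A B : set V) :
  B !=set0 -> B `<=` A -> adim B = adim A -> affine_hull A `<=` affine_hull B.
Proof.
move=> [y By] BA dimE x Ax.
have Ay := BA _ By.
have /eqP DE : direction B == direction A.
  rewrite eqEdim (direction_min By) => [|z Bz]; last first.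
    by apply: mem_direction_sub => //; exact: BA.
  have [B0 A0] : B !=set0 /\ A !=set0 by split; exists y.
  by move: dimE; rewrite !adimE// => -[->]; rewrite leqnn.
rewrite -(subrK y x) addrC; apply: affine_hull_direction.
  exact: sub_affine_hull.
by rewrite DE mem_direction//; exact: sub_affine_hull.
Qed.

Lemma range_convex (V W : vectType R) (Y : set V) (f : Y -> W) :
  convex_set Y -> affine_map f -> convex_set (range f).
Proof.
move=> /convex_setP cY fA; apply/convex_setP => _ _ t [y1 _ <-] [y2 _ <-] t0 t1.
have Yy : Y (t *: set_val y1 + (1 - t) *: set_val y2).
  by apply: cY => //; exact: set_valP.
exists (point_of Yy) => //.
rewrite (fA 2 (fun i => if i == ord0 then y1 else y2)
  (fun i => if i == ord0 then t else 1 - t)) !big_ord_recl !big_ord0/= !addr0//.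
by lra.
Qed.

Lemma affine_hom_comp (k n : nat) (X : set 'rV[R]_n) (P F : set 'rV[R]_k)
    (FP : F `<=` P) (g : P -> 'rV[R]_n) :
  affine_hom X g -> affine_hom X (g \o subfun FP).
Proof.
move=> [gA gX]; split=> [r x t y t1 yE|_ [x _ <-]]; last by apply: gX; exists (subfun FP x).
exact: gA.
Qed.

Section FullDimensionalImage.
Variables (m n : nat) (Y : set 'rV[R]_m) (X : set 'rV[R]_n) (f : Y -> 'rV[R]_n).
Hypotheses (Y_nonempty : Y !=set0) (X_compact : compact X) (fX : range f `<=` X)
  (dim_f : adim (range f) = adim X).

Lemma range_nonempty : range f !=set0.
Proof. by have [y Yy] := Y_nonempty; exists (f (point_of Yy)), (point_of Yy). Qed.

Lemma affine_hull_range : affine_hull X `<=` affine_hull (range f).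
Proof. exact: affine_hull_same_dim range_nonempty fX dim_f. Qed.

(** All conditions on the right pass to pointwise limits.  For the last one, the
    relative interior of the image of [f] is open in [X], because the image and
    [X] have the same affine hull. *)
Lemma complementingP k (Z : set 'rV[R]_k) (g : Z -> 'rV[R]_n) :
  complementing X f Z g <->
  affine_hom X g /\ range g `&` relint (range f) = set0.
Proof.
split=> [|H]; last exact: (@subset_closure {ptws Z -> 'rV[R]_n}).
rewrite /complementing closureEcvg => -[G PG [Gg GS]].
have Gev (z : Z) : h z @[h --> G] --> g z.
  by have := @proj_continuous Z (fun=> 'rV[R]_n) z g; apply: cvg_trans; exact: cvg_app.
have GS' : \forall h \near G, affine_hom X h /\ range h `&` relint (range f) = set0.
  by apply: GS.
have gX z : X (g z).
  have clX : closed X by apply: compact_closed => //; exact: norm_hausdorff.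
  have := @closed_cvg _ _ G _ (fun h : Z -> 'rV[R]_n => h z) X clX; apply; last exact: Gev.
  by apply: filterS GS' => h [[_ hX] _]; apply: hX; exists z.
split; first split.
- move=> r x t y t1 yE; apply/eqP; rewrite -subr_eq0; apply/eqP.
  have H : h y - \sum_(i < r) t i *: h (x i) @[h --> G] -->
      g y - \sum_(i < r) t i *: g (x i).
    apply: cvgB; first exact: Gev.
    by apply: cvg_lincomb => i; [exact: cvg_cst|exact: Gev].
  have cl0 : closed [set (0 : 'rV[R]_n)].
    exact/accessible_closed_set1/hausdorff_accessible/norm_hausdorff.
  have := @closed_cvg _ _ G _ _ _ cl0; apply; last exact: H.
  by apply: filterS GS' => h [[hA _] _]; rewrite (hA _ x t y)//= subrr.
- by move=> _ [z _ <-].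
apply/seteqP; split=> // _ [[z _ <-] Kz].
have : \forall h \near G, affine_hull (range f) (h z) -> relint (range f) (h z).
  exact: (Gev z _ (relint_near Kz)).
move=> /(filterI GS')/filter_ex[h [[[_ hX] hK] Hh]].
have hz : range h (h z) by exists z.
suff : (range h `&` relint (range f)) (h z) by rewrite hK.
by split=> //; apply/Hh/affine_hull_range/sub_affine_hull/hX.
Qed.

Variables (k : nat) (P : set 'rV[R]_k).

(** The image of [g] contains the image of [f], which has the dimension of [P];
    so [g] does not lower dimensions. *)
Lemma sandwiching_injective (L : {linear 'rV[R]_k -> 'rV[R]_n}) b (g : P -> 'rV[R]_n) :
  adim P = adim X -> sandwiching X f P g -> (forall x, g x = L (set_val x) + b) ->
  forall u, u \in direction P -> L u = 0 -> u = 0.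
Proof.
move=> dimP [[gA gX] fg] gE u uP Lu.
have [y0 fy0] := range_nonempty; have [x0 _ x0E] := fg _ fy0.
have Px0 := set_valP x0.
have le : (direction (range f) <= linfun L @: direction P)%VS.
  apply: (direction_min fy0) => _ /fg[x _ <-].
  rewrite -x0E !gE opprD addrACA subrr addr0 -linearB -[L _](lfunE L).
  by apply: memv_img; apply: mem_direction_sub => //; exact: set_valP.
have := limg_ker_dim (linfun L) (direction P).
have : (\dim (direction P) <= \dim (linfun L @: direction P))%N.
  apply: leq_trans (dimvS le); move: dimP; rewrite -dim_f !adimE => [[->]//||].
    exact: range_nonempty.
  by exists (set_val x0).
move=> dle dE.
have : (\dim (direction P :&: lker (linfun L)) <= 0)%N.
  by rewrite -(leq_add2r (\dim (linfun L @: direction P))) dE add0n.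
rewrite leqn0 dimv_eq0 => /eqP k0.
have : u \in (direction P :&: lker (linfun L))%VS.
  by rewrite memv_cap uP memv_ker lfunE/= Lu.
by rewrite k0 memv0 => /eqP.
Qed.

(** Suppose that [g x] is interior to the image of [f], and let [q] be a point of
    [P] outside [F].  Moving [g x] a little away from [g q] stays in the image of
    [f], hence of [g]; as [g] is injective, [x] lies strictly between [q] and
    another point of [P], which contradicts that [F] is a face. *)
Lemma sandwiching_face (g : P -> 'rV[R]_n) F : adim P = adim X ->
  sandwiching X f P g -> proper_face P F ->
  forall x : P, F (set_val x) -> ~ relint (range f) (g x).
Proof.
move=> dimP gS [[l [c [lc FE]]] FP] x Fx rx.
have [L [b gE]] := affine_map_extension gS.1.1.
have [[gA gX] fg] := gS.
have [q [Pq lq]] : exists q, P q /\ l q < c.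
  apply: contrapT => nq; apply: FP; rewrite FE; apply/seteqP; split=> [z []//|z Pz].
  split=> //; apply/eqP; rewrite eq_le lc//= leNgt.
  by apply/negP => zc; apply: nq; exists z.
have [Px lx] : P (set_val x) /\ l (set_val x) = c by rewrite FE in Fx.
have gqX : X (g (point_of Pq)) by apply: gX; exists (point_of Pq).
have gxX : X (g x) by apply: gX; exists x.
have [|e e0 He] := relint_move (u := g x - g (point_of Pq)) rx.
  by apply: mem_direction; apply/affine_hull_range/sub_affine_hull.
have [|z _ zE] := fg (g x + e *: (g x - g (point_of Pq))).
  by apply: He; rewrite gtr0_norm.
pose w : 'rV[R]_k := set_val z - set_val x - e *: (set_val x - q).
have : w = 0.
  apply: (sandwiching_injective dimP gS gE).
    by rewrite memvB ?memvZ// mem_direction_sub//; exact: set_valP.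
  have LB u v : L (u - v) = L u - L v by exact: linearB.
  move: zE; rewrite !gE /w !LB linearZ/= LB.
  rewrite opprD addrACA subrr addr0 addrAC => /addIr ->.
  by rewrite addrAC addrK subrr.
move=> /(congr1 l); rewrite /w linear0 !(linearB l) linearZ (linearB l)/= lx.
have := lc _ (set_valP z).
have : 0 < e * (c - l q) by rewrite mulr_gt0// subr_gt0.
lra.
Qed.

Lemma linear_boundary_continuous (L : {linear 'rV[R]_k -> 'rV[R]_n}) b :
  continuous (fun x : boundary P => L (set_val x) + b).
Proof.
move=> x; apply: (@cvgD _ _ _ (nbhs x)); last exact: (@cvg_cst _ _ _ (nbhs x) _).
apply: (@continuous_comp _ _ _ (set_val : boundary P -> 'rV[R]_k) L).
  exact: initial_continuous.
by apply: linear_rV_continuous => a u v; rewrite linearP.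
Qed.

Lemma restrict_boundary_fun (dim_P : adim X <= adim P)
    (S_empty : adim X < adim P -> sandwiching X f P = set0) :
  set_fun (sandwiching X f P `|` complementing X f P) (lim_complementing X f P)
    (restrict_boundary P).
Proof.
move=> g gSC.
have gh : affine_hom X g by case: gSC => [[]//|/complementingP[]].
have [L [b gE]] := affine_map_extension gh.1.
split.
- have -> : restrict_boundary P g = (fun x : boundary P => L (set_val x) + b).
    by apply/funext => x; rewrite /restrict_boundary/= gE.
  exact: linear_boundary_continuous.
- move=> _ [x _ <-]; apply: gh.2.
  by exists (subfun (@boundary_sub R k P) x).
move=> F pF.
have FP := face_sub pF.1.
have -> : restrict_boundary P g \o subfun (proper_face_boundary pF) = g \o subfun FP.
  by apply/funext => x /=; rewrite /restrict_boundary/=; congr g; exact: val_inj.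
have hF := affine_hom_comp FP gh.
split; first exact: hF.1.
apply/complementingP; split=> //; apply/seteqP; split=> // y [[x _ <-]] /= ry.
case: gSC => [gS|/complementingP[_ gK]]; last first.
  suff : (range g `&` relint (range f)) (g (subfun FP x)) by rewrite gK.
  by split=> //; exists (subfun FP x).
move: dim_P; rewrite le_eqVlt => /orP[/eqP dP|/S_empty S0]; last by rewrite S0 in gS.
exact: (@sandwiching_face _ _ (esym dP) gS pF (subfun FP x) (set_valP x)).
Qed.

End FullDimensionalImage.
End SandwichComplementTheory.

(** * Maps determined by their values at the vertices *)

Section Vertices.
Variables (R : realType) (V : vectType R).
Implicit Types (P F : set V) (v x y : V).

Lemma adim_le0 (A : set V) x y : adim A <= 0 -> A x -> A y -> x = y.
Proof.
move=> dA Ax Ay; move: dA; rewrite adimE; last by exists x.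
rewrite lez_nat leqn0 dimv_eq0 => /eqP d0.
have : x - y \in direction A by exact: mem_direction_sub.
by rewrite d0 memv0 subr_eq0 => /eqP.
Qed.

Lemma adim_set1 v : adim [set v] = 0.
Proof.
rewrite adimE; last by exists v.
have : (direction [set v] <= 0)%VS.
  by apply: (@direction_min _ _ _ v) => // x ->; rewrite subrr mem0v.
by rewrite subv0 => /eqP ->; rewrite dimv0.
Qed.

Lemma mem_range_hull n (a : 'I_n -> V) P i : P = convex_hull (range a) -> P (a i).
Proof. by move=> ->; apply: sub_convex_hull; exists i. Qed.

Lemma affine_eq_on_hull (W : vectType R) (L1 L2 : {linear V -> W}) b1 b2 n
    (a : 'I_n -> V) : (forall i, L1 (a i) + b1 = L2 (a i) + b2) ->
  forall x, convex_hull (range a) x -> L1 x + b1 = L2 x + b2.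
Proof.
move=> La x /convex_hull_range[t [_ t1 ->]].
by rewrite !affine_sum//; apply: eq_bigr => i _; rewrite La.
Qed.

End Vertices.

Lemma vertex_boundary (R : realType) (k : nat) (P : set 'rV[R]_k) v :
  vertex P v -> P <> [set v] -> boundary P v.
Proof.
move=> Pv Pnv; apply: (@proper_face_boundary _ _ P [set v]) => //.
by split=> // /esym.
Qed.

Section Injectivity.
Variables (R : realType) (m n k : nat) (Y : set 'rV[R]_m) (X : set 'rV[R]_n)
  (P : set 'rV[R]_k) (f : Y -> 'rV[R]_n).
Hypotheses (Y_nonempty : Y !=set0) (X_compact : compact X) (fX : range f `<=` X)
  (dim_f : adim (range f) = adim X) (P_polytope : polytope P)
  (dim_P : adim X <= adim P).

(** An affine map is determined by its values at the vertices, which are boundary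
    points unless [P] is a point; in that case [X] is a point too. *)
Lemma restrict_boundary_inj :
  set_inj (sandwiching X f P `|` complementing X f P) (restrict_boundary P).
Proof.
have hom g : (sandwiching X f P `|` complementing X f P) g -> affine_hom X g.
  by case=> [[]//|/(complementingP Y_nonempty X_compact fX dim_f)[]].
move=> g1 g2 /set_mem/hom g1h /set_mem/hom g2h rho12; apply/funext => x.
have [n0 [a [_ PE Pa]]] := polytope_vertices P_polytope.
have [[v Pv]|nv] := pselect (exists v, P = [set v]).
  have dX : adim X <= 0 by move: dim_P; rewrite Pv adim_set1.
  by apply: (adim_le0 dX); [apply: g1h.2|apply: g2h.2]; exists x.
have [L1 [b1 g1E]] := affine_map_extension g1h.1.
have [L2 [b2 g2E]] := affine_map_extension g2h.1.
rewrite g1E g2E; apply: (@affine_eq_on_hull _ _ _ _ _ _ _ _ a); last first.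
  by rewrite -PE; exact: set_valP.
move=> i; have bi : boundary P (a i).
  by apply: vertex_boundary; [apply/Pa; exists i|move=> Pi; apply: nv; exists (a i)].
have := congr1 (@^~ (point_of bi)) rho12.
by rewrite /restrict_boundary/= g1E g2E.
Qed.

End Injectivity.

(** * Bending a polytope at a vertex with simplicial facets *)

Section VertexWeight.
Variables (R : realType) (V : vectType R).
Implicit Types (P F : set V) (v x y : V).

(** Barycentric coordinates. *)
Lemma simplex_coordinate r (x : 'I_r -> V) j : affinely_independent x ->
  exists (l : {scalar V}) (c : R), forall i, l (x i) + c = (i == j)%:R.
Proof.
move=> xind; pose h i : (V * R^o)%type := (x i, 1).
pose b := [tuple (if i == j then 0 else h i) | i < r].
have bE (i : 'I_r) : b`_i = if i == j then 0 else h i by rewrite -tnth_nth tnth_mktuple.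
have hj : h j \notin <<b>>%VS.
  apply/negP => /coord_span hE.
  pose t i := if i == j then -1 else coord b i (h j).
  have tE i : t i *: h i = (if i == j then - h j else 0) + coord b i (h j) *: b`_i.
    by rewrite /t bE; case: eqVneq => [->|_]; rewrite ?scaler0 ?addr0 ?scaleN1r ?add0r.
  have t0 : \sum_i t i *: h i = 0.
    by under eq_bigr do rewrite tE; rewrite big_split/= -hE -big_mkcond big_pred1_eq addNr.
  have : t j = 0.
    apply: xind.
      have /= := congr1 snd t0; rewrite raddf_sum/= => tE0; rewrite -[RHS]tE0.
      by apply: eq_bigr => i _; rewrite /= /GRing.scale/= mulr1.
    have /= := congr1 fst t0; rewrite raddf_sum/= => tE0; rewrite -[RHS]tE0.
    by apply: eq_bigr.
  by rewrite /t eqxx => /eqP; rewrite oppr_eq0 oner_eq0.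
have [H [Hb Hj]] := functional_separating hj.
have [|l lE] := @functional_of R V (fun u => H (u, 0)).
  move=> c u w; rewrite -linearP; congr (H _).
  by congr pair; rewrite /= scaler0 addr0.
exists l, (H (0, 1)) => i; rewrite lE -linearD.
have -> : (x i, 0) + (0, 1) = h i by congr pair; rewrite /= ?addr0 ?add0r.
case: eqVneq => [->//|ij].
apply: Hb; apply: memv_span.
have : b`_i \in b by rewrite mem_nth// size_tuple.
by rewrite bE (negPf ij).
Qed.

(** On a proper face, the weight of [a i0] does not depend on how a point is
    written as a convex combination of the vertices, and is affine: the face
    lies in a simplex, or else it misses [a i0]. *)
Lemma vertex_weight_affine n (a : 'I_n -> V) P i0 F :
  injective a -> P = convex_hull (range a) ->
  (forall v, vertex P v <-> exists i, v = a i) ->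
  (forall G, facet P G -> G (a i0) -> simplex G) -> proper_face P F ->
  exists (l : {scalar V}) (c : R), forall t : 'I_n -> R,
    (forall i, 0 <= t i) -> \sum_i t i = 1 -> F (\sum_i t i *: a i) ->
    t i0 = l (\sum_i t i *: a i) + c.
Proof.
move=> ainj PE Pa Gsimp pF.
have aP i : P (a i) by exact: mem_range_hull PE.
have [Fv|nFv] := pselect (F (a i0)); last first.
  have [|l l0] := @functional_of R V (fun=> 0); first by move=> *; rewrite mulr0 addr0.
  exists l, 0 => t t0 t1 Ft; rewrite l0 addr0.
  apply/eqP; rewrite eq_le t0 andbT leNgt; apply/negP => ti; apply: nFv.
  exact: (face_weights pF.1 aP t0 t1 Ft).
have Ppoly : polytope P by rewrite PE; exact: range_polytope.
have [m [lm fG FG]] := proper_face_facet Ppoly pF Fv.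
set G := [set _ | _] in fG FG.
have GP := face_sub fG.1.
have [r [y [yind GE]]] := Gsimp _ fG (FG _ Fv).
have yG j : G (y j) by rewrite GE; apply: sub_convex_hull; exists j.
have vy i : G (a i) -> exists j, a i = y j.
  move=> Gi; have := Gi; rewrite {1}GE => /convex_hull_range[t [t0 t1 aE]].
  apply: (vertex_weights (P := P) _ _ t0 t1 aE); first by apply/Pa; exists i.
  by move=> j; exact/GP/yG.
have [j0 aj0] := vy _ (FG _ Fv).
have [l [c lc]] := simplex_coordinate j0 yind.
exists l, c => t t0 t1 Ft.
have -> : l (\sum_i t i *: a i) + c = \sum_i t i * (l (a i) + c).
  under [RHS]eq_bigr do rewrite mulrDr.
  rewrite big_split/= -mulr_suml t1 mul1r linear_sum; congr (_ + _).
  by apply: eq_bigr => i _; rewrite linearZ.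
rewrite (bigD1 i0)//= aj0 lc eqxx mulr1 big1 ?addr0// => i ii0.
have [->|ti] := eqVneq (t i) 0; first by rewrite mul0r.
have [|j aj] := vy i.
  by apply: FG; apply: (face_weights pF.1 aP t0 t1 Ft); rewrite lt_neqAle eq_sym ti t0.
rewrite aj lc (_ : j == j0 = false) ?mulr0//.
apply/negP => /eqP jj0; move/eqP: ii0; apply; apply: ainj.
by rewrite aj jj0.
Qed.

End VertexWeight.

Section Bending.
Variables (R : realType) (k : nat).
Implicit Types (P F : set 'rV[R]_k).

(** The faces are finitely many and closed: near [x], a boundary point lies only
    on faces that contain [x]. *)
Lemma facewise_affine_continuous P (h : boundary P -> R) : polytope P ->
  (forall F, proper_face P F -> exists (l : {scalar 'rV[R]_k}) (c : R),
    forall x : boundary P, F (set_val x) -> h x = l (set_val x) + c) ->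
  continuous h.
Proof.
move=> Ppoly hF x.
have [n [a PE]] := polytope_range Ppoly.
pose FS (S : {set 'I_n}) := convex_hull (a @` [set` S]).
have clF S : closed (FS S).
  apply: compact_closed; first exact: norm_hausdorff.
  by apply: polytope_compact; exists (a @` [set` S]) => //; exact: finite_image.
have FSE F : face P F -> exists S, F = FS S.
  rewrite PE => /face_range FE; exists [set i | `[< F (a i) >]]%SET.
  rewrite FE /FS; congr (convex_hull (_ @` _)); apply/seteqP.
  by split=> i /=; rewrite inE => /asboolP; rewrite -FE.
have /choice[lc lcP] : forall S : {set 'I_n}, exists lc : {scalar 'rV[R]_k} * R,
    proper_face P (FS S) -> forall x : boundary P, FS S (set_val x) ->
      h x = lc.1 (set_val x) + lc.2.
  move=> S; have [/hF[l [c lcE]]|nS] := pselect (proper_face P (FS S)).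
    by exists (l, c).
  have [|l _] := @functional_of R 'rV[R]_k (fun=> 0); first by move=> *; rewrite mulr0 addr0.
  by exists (l, 0).
apply/(@cvgrPdist_lt _ _ _ (nbhs x)) => e e0.
have nearS : \forall y \near set_val x, forall S : {set 'I_n},
    (FS S y -> FS S (set_val x)) /\ `|(lc S).1 (set_val x) - (lc S).1 y| < e.
  apply: (@filter_forall _ _ _ (nbhs (set_val x))) => S.
  apply: (@filterI _ (nbhs (set_val x))); last first.
    by have /cvgrPdist_lt := @functional_continuous R k (lc S).1 (set_val x); apply.
  have [xS|xS] := pselect (FS S (set_val x)).
    exact: (@nearW _ (nbhs (set_val x))).
  have : nbhs (set_val x) (~` FS S).
    by apply: open_nbhs_nbhs; split=> //; exact: closed_openC.
  by apply: (@filterS _ (nbhs (set_val x))) => y nS yS.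
have := @initial_continuous _ _ (set_val : boundary P -> 'rV[R]_k) x _ nearS.
apply: (@filterS _ (nbhs x)) => y /= Hy.
have [F [pF Fy]] := boundary_proper_face Ppoly (set_valP y).
have [S FE] := FSE _ pF.1; rewrite FE in pF Fy.
have [/(_ Fy) Fx d] := Hy S.
by rewrite (lcP S pF x Fx) (lcP S pF y Fy) opprD addrACA subrr addr0.
Qed.

End Bending.

Section NonSurjectivity.
Variable R : realType.

Lemma range_closed (m n : nat) (Y : set 'rV[R]_m) (f : Y -> 'rV[R]_n) :
  compact Y -> affine_map f -> closed (range f).
Proof.
move=> cY fA; have [L [b fE]] := affine_map_extension fA.
apply: compact_closed; first exact: norm_hausdorff.
have -> : range f = (fun y => L y + b) @` Y.
  apply/seteqP; split=> [_ [y _ <-]|_ [y Yy <-]].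
    by exists (set_val y); [exact: set_valP|rewrite fE].
  by exists (point_of Yy) => //; rewrite fE.
apply: continuous_compact => //; apply: continuous_subspaceT => y.
apply: (@cvgD _ _ _ (nbhs y)); last exact: (@cvg_cst _ _ _ (nbhs y) _).
by apply: linear_rV_continuous => c u v; rewrite linearP.
Qed.

(** Start at a point of [X] that is not relatively interior, hence not in [B],
    and go a little way towards another point of [X]. *)
Lemma segment_avoiding (n : nat) (X B : set 'rV[R]_n) :
  compact X -> convex_set X -> 0 < adim X -> closed B -> B `<=` relint X ->
  exists x0 x1 : 'rV[R]_n, x0 != x1 /\
    forall t, 0 <= t -> t <= 1 -> X (x0 + t *: (x1 - x0)) /\ ~ B (x0 + t *: (x1 - x0)).
Proof.
move=> cX convX dX clB BX.
have [x Xx] : X !=set0.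
  by apply/set0P/eqP => X0; move: dX; rewrite /adim; case: asboolP.
have [u uX u0] : exists2 u, u \in direction X & u != 0.
  move: dX; rewrite adimE; last by exists x.
  rewrite ltz_nat lt0n dimv_eq0 => /eqP d0; exists (vpick (direction X)).
    exact: memv_pick.
  by rewrite vpick0; apply/eqP.
have [t t0 [Xw nrw]] := ray_exit cX Xx uX u0.
set w := x + t *: u in Xw nrw.
have [z Xz zw] : exists2 z, X z & z != w.
  have [xw|] := eqVneq x w; last by exists x.
  apply: contrapT => nz.
  suff : (direction X <= 0)%VS.
    by rewrite subv0 => /eqP d0; move: uX; rewrite d0 memv0 (negPf u0).
  apply: (direction_min Xw) => y Xy; rewrite memv0 subr_eq0.
  by apply/negPn/negP => yw; apply: nz; exists y.
have Bw : nbhs w (~` B).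
  by apply: open_nbhs_nbhs; split; [exact: closed_openC|move=> /BX].
have : \forall s \near (0 : R), ~ B (w + s *: (z - w)).
  have H : w + s *: (z - w) @[s --> (0 : R)] --> w.
    by have := @segment_cvg R n w (z - w) 0; rewrite scale0r addr0.
  exact: (H _ Bw).
move=> /nbhs_ballP[e /= e0 He].
pose d := Num.min (e / 2) 1.
have d0 : 0 < d by rewrite lt_min divr_gt0//= ltr01.
have d1 : d <= 1 by rewrite ge_min lexx orbT.
have de : d < e.
  by rewrite (@le_lt_trans _ _ (e / 2))// ?ge_min ?lexx// ltr_pdivrMr// ltr_pMr// ltr1n.
exists w, (w + d *: (z - w)); split.
  by rewrite -subr_eq0 opprD addrA subrr add0r oppr_eq0 scaler_eq0 gt_eqF//= subr_eq0.
move=> s s0 s1; have -> : w + d *: (z - w) - w = d *: (z - w).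
  by rewrite addrAC subrr add0r.
rewrite scalerA.
have sd0 : 0 <= s * d by rewrite mulr_ge0// ltW.
have sd1 : s * d <= d by rewrite ler_piMl// ltW.
split.
  have := (convex_setP X).1 convX z w (s * d) Xz Xw sd0 (le_trans sd1 d1).
  by rewrite scalerBl scale1r addrCA -scalerBr.
apply: He; rewrite /ball/= sub0r normrN ger0_norm//.
exact: le_lt_trans de.
Qed.

Variables (m n k : nat) (Y : set 'rV[R]_m) (X : set 'rV[R]_n)
  (P : set 'rV[R]_k) (f : Y -> 'rV[R]_n).
Hypotheses (Y_nonempty : Y !=set0) (Y_compact : compact Y)
  (X_compact : compact X) (X_convex : convex_set X) (f_affine : affine_hom X f)
  (P_polytope : polytope P) (dim_f : adim (range f) = adim X)
  (dim_P : adim X <= adim P) (S_empty : adim X < adim P -> sandwiching X f P = set0).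

Lemma adim_ge0 (V : vectType R) (A : set V) : A !=set0 -> 0 <= adim A.
Proof. by move=> /adimE ->. Qed.

(** If [X] were a point, a constant map would be sandwiching. *)
Lemma adim_image_gt0 : 0 < adim P -> 0 < adim X.
Proof.
move=> dP; have [x Xx] : X !=set0.
  by have [y fy] := range_nonempty f Y_nonempty; exists y; exact: f_affine.2.
have X0 : 0 <= adim X by apply: adim_ge0; exists x.
rewrite lt_neqAle X0 andbT eq_sym; apply/negP => /eqP dX.
have /S_empty : adim X < adim P by rewrite dX.
move=> /seteqP[+ _] => /(_ (fun=> x)); apply; split; first split.
- move=> r y t z t1 _; by rewrite -scaler_suml t1 scale1r.
- by move=> _ [_ _ <-].
have [p Pp] : P !=set0.
  by apply/set0P/eqP => P0; move: dP; rewrite /adim; case: asboolP.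
move=> y fy; exists (point_of Pp) => //.
by apply: (adim_le0 (A := X)) => //; [rewrite dX|exact: f_affine.2].
Qed.

(** Fold [P] onto a segment [x0, x1] of [X] that misses the image of [f]: the
    apex [v] goes to [x1], every other vertex to [x0], and a boundary point goes
    to the point that divides the segment according to its weight at [v]. *)
Lemma restrict_boundary_not_surj (v : 'rV[R]_k) :
  range f `<=` relint X -> vertex P v ->
  (forall F, facet P F -> F v -> simplex F) -> ~ pyramid_with_apex P v ->
  ~ set_surj (sandwiching X f P `|` complementing X f P) (lim_complementing X f P)
      (restrict_boundary P).
Proof.
move=> fX Pv Fsimp npyr surj.
have [r [a [ainj PE Pa]]] := polytope_vertices P_polytope.
have [i0 vE] := (Pa v).1 Pv; subst v.
have aP i : P (a i) by exact: mem_range_hull PE.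
have cP : convex_set P by rewrite PE; exact: convex_hull_convex.
have av i : vertex P (a i) by apply/Pa; exists i.
pose Q := convex_hull (a @` [set i | i != i0]).
have QP : Q `<=` P.
  by apply: convex_hull_min => // _ [i _ <-].
apply: npyr; exists Q; split.
- by exists (a @` [set i | i != i0]) => //; apply: finite_image; exact: finite_finset.
- move=> aQv.
  have [_ [k1 [y1 [t1 [ay t10 t1s _]]]]] := affine_hull_nonempty aQv.
  have [j1 _] := positive_weight t10 t1s.
  have [i1 /= i10 _] := ay j1.
  have nP1 i : P <> [set a i].
    move=> Pi; have e1 : a i1 = a i by have := aP i1; rewrite {1}Pi.
    have e0 : a i0 = a i by have := aP i0; rewrite {1}Pi.
    by move/eqP: i10; apply; apply: ainj; rewrite e1 e0.
  have ba i : boundary P (a i) by apply: vertex_boundary.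
  have dP : 0 < adim P.
    rewrite lt_neqAle adim_ge0 ?andbT; last by exists (a i0).
    apply/negP => /eqP dP0; apply: (nP1 i0); apply/seteqP; split=> [x Px|x ->//].
    by apply: (adim_le0 (A := P)) => //; rewrite -dP0.
  have [x0 [x1 [x01 xB]]] := segment_avoiding X_compact X_convex (adim_image_gt0 dP)
    (range_closed Y_compact f_affine.1) fX.
  have /choice[w wP] : forall x : boundary P, exists t : 'I_r -> R,
      [/\ forall i, 0 <= t i, \sum_i t i = 1 & set_val x = \sum_i t i *: a i].
    move=> x; have := boundary_sub (set_valP x); rewrite {1}PE.
    by move=> /convex_hull_range.
  have wF F : proper_face P F -> exists (l : {scalar 'rV[R]_k}) (c : R),
      forall t : 'I_r -> R, (forall i, 0 <= t i) -> \sum_i t i = 1 ->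
      F (\sum_i t i *: a i) -> t i0 = l (\sum_i t i *: a i) + c.
    exact: vertex_weight_affine.
  have wa i : w (point_of (ba i)) i0 = (i == i0)%:R.
    have [|l [c lc]] := wF [set a i]; first by split; [exact: av|exact/nesym].
    have [t0 ts aE] := wP (point_of (ba i)).
    rewrite (lc _ t0 ts) -?aE//=.
    have := lc (fun j => (i == j)%:R).
    have -> : \sum_j (i == j)%:R *: a j = a i.
      rewrite (bigD1 i)//= eqxx scale1r big1 ?addr0// => j /negPf.
      by rewrite eq_sym => ->; rewrite scale0r.
    move=> <- //; rewrite (bigD1 i)//= eqxx big1 ?addr0// => j /negPf.
    by rewrite eq_sym => ->.
  pose c (x : boundary P) := x0 + w x i0 *: (x1 - x0).
  have w01 x : 0 <= w x i0 /\ w x i0 <= 1.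
    have [t0 <- _] := wP x; split=> //.
    by rewrite (bigD1 i0)//= lerDl sumr_ge0.
  have cB x : X (c x) /\ ~ range f (c x) by have [w0 w1] := w01 x; exact: xB.
  have Lc : lim_complementing X f P c.
    split.
    + move=> x; apply: (@cvgD _ _ _ (nbhs x)); first exact: (@cvg_cst _ _ _ (nbhs x) _).
      apply: (@cvgZr_tmp _ _ _ (nbhs x)).
      apply: (facewise_affine_continuous P_polytope) => F /wF[l [d ld]].
      exists l, d => y Fy; have [t0 ts yE] := wP y.
      by rewrite (ld _ t0 ts) -yE.
    + by move=> _ [x _ <-]; have [] := cB x.
    move=> F pF.
    have cA : affine_map (c \o subfun (proper_face_boundary pF)).
      have [l [d ld]] := wF F pF.
      move=> s z t y ts yE.
      have wE (x : F) : w (subfun (proper_face_boundary pF) x) i0 = l (set_val x) + d.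
        have [t0 ts' xE] := wP (subfun (proper_face_boundary pF) x).
        by rewrite (ld _ t0 ts') -xE//=; exact: (set_valP x).
      rewrite /c/=; under [RHS]eq_bigr do rewrite scalerDr scalerA wE.
      rewrite big_split/= -!scaler_suml ts scale1r wE yE linear_sum.
      congr (_ + _ *: _); under [RHS]eq_bigr do rewrite mulrDr.
      rewrite big_split/= -mulr_suml ts mul1r; congr (_ + _).
      by apply: eq_bigr => i _; rewrite linearZ.
    split=> //; apply/(complementingP Y_nonempty X_compact f_affine.2 dim_f); split.
      split=> // _ [x _ <-].
      by have [] := cB (subfun (proper_face_boundary pF) x).
    apply/seteqP; split=> // _ [[x _ <-]] [fx _].
    by have [_] := cB (subfun (proper_face_boundary pF) x).
  have [g gSC rg] := surj _ Lc.
  have gA : affine_map g.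
    by case: gSC => [[[]]//|/(complementingP Y_nonempty X_compact f_affine.2 dim_f)[[]]].
  have [L [b gE]] := affine_map_extension gA.
  have ga i : L (a i) + b = x0 + (i == i0)%:R *: (x1 - x0).
    have := congr1 (@^~ (point_of (ba i))) rg.
    by rewrite /restrict_boundary/= gE /c wa.
  have gQ y : Q y -> L y + b = x0.
    move=> [s [z [t [az t0 ts ->]]]]; rewrite affine_sum//.
    rewrite -[RHS]scale1r -ts scaler_suml; apply: eq_bigr => j _.
    by have [i /= /negPf ii0 <-] := az j; rewrite ga ii0 scale0r addr0.
  have : L (a i0) + b = x0.
    have [s [z [t [Qz ts ->]]]] := aQv; rewrite affine_sum//.
    by rewrite -[RHS]scale1r -ts scaler_suml; apply: eq_bigr => j _; rewrite gQ.
  rewrite ga eqxx scale1r addrC subrK => x10.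
  by rewrite x10 eqxx in x01.
- apply/seteqP; split; last first.
    by apply: convex_hull_min => // x [/QP//|->].
  rewrite PE; apply: convex_hull_min; first exact: convex_hull_convex.
  move=> _ [i _ <-]; apply: sub_convex_hull.
  have [->|ii0] := eqVneq i i0; [by right|left].
  by apply: sub_convex_hull; exists i.
Qed.

End NonSurjectivity.

(** * Simple polytopes *)

Section SimpleVertices.
Variables (R : realType) (V : vectType R).
Implicit Types (P F G : set V) (u v w x y : V) (l : {scalar V}).

Lemma functional_nonconstant P l v : facet P [set x | P x /\ l x = l v] -> P v ->
  (forall x, P x -> l x <= l v) -> exists2 x, P x & l x < l v.
Proof.
move=> [_ dF] Pv lv; apply: contrapT => nx.
suff FE : [set x | P x /\ l x = l v] = P.
  by move: dF; rewrite FE => /eqP; rewrite -subr_eq0 opprB addrC subrK oner_eq0.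
apply/seteqP; split=> [x []//|x Px]; split=> //; apply/eqP; rewrite eq_le lv//=.
by rewrite leNgt; apply/negP => xv; apply: nx; exists x.
Qed.

(** The direction of the facet is contained in the hyperplane [l = 0] of the
    direction of [P] and has the same dimension. *)
Lemma facet_direction P l v u : P v -> (forall x, P x -> l x <= l v) ->
  facet P [set x | P x /\ l x = l v] -> u \in direction P -> l u = 0 ->
  u \in direction [set x | P x /\ l x = l v].
Proof.
move=> Pv lv fF uP lu; set F := [set _ | _] in fF *.
have Fv : F v by [].
have [q Pq lq] := functional_nonconstant fF Pv lv.
have lE w : linfun (l : V -> R^o) w = l w by rewrite lfunE.
pose K := (direction P :&: lker (linfun (l : V -> R^o)))%VS.
have FK : (direction F <= K)%VS.
  apply: (direction_min Fv) => x [Px lx].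
  by rewrite memv_cap mem_direction_sub//= memv_ker lE linearB/= lx subrr eqxx.
have KP : (K <= direction P)%VS by exact: capvSl.
have Klt : (\dim K < \dim (direction P))%N.
  rewrite ltnNge; apply/negP => dle.
  have /eqP KE : K == direction P by rewrite eqEdim KP.
  have : q - v \in K by rewrite KE mem_direction_sub.
  rewrite memv_cap memv_ker lE linearB/= subr_eq0 => /andP[_ /eqP lqv].
  by rewrite lqv ltxx in lq.
have dF : (\dim (direction F)).+1 = \dim (direction P).
  move: fF.2; rewrite !adimE; [|by exists v..] => /eqP.
  by rewrite eq_sym subr_eq -PoszD addn1 => /eqP[].
have /eqP -> : direction F == K by rewrite eqEdim FK -ltnS dF.
by rewrite memv_cap uP memv_ker lE lu eqxx.
Qed.

(** Both functionals vanish on the direction of the facet, a hyperplane, and are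
    negative on the way from [v] into the rest of [P]; so they are positively
    proportional on the direction of [P]. *)
Lemma facet_functional_sign P l l' v u : P v ->
  (forall x, P x -> l x <= l v) -> (forall x, P x -> l' x <= l' v) ->
  facet P [set x | P x /\ l x = l v] ->
  [set x | P x /\ l x = l v] = [set x | P x /\ l' x = l' v] ->
  u \in direction P -> l u <= 0 -> l' u <= 0.
Proof.
move=> Pv lv l'v fF FF' uP lu.
have [q Pq lq] := functional_nonconstant fF Pv lv.
have lqv : l (q - v) < 0 by rewrite linearB subr_lt0.
pose t := l u / l (q - v).
have t0 : 0 <= t by rewrite mulr_le0// invr_le0 ltW.
have qP : q - v \in direction P by exact: mem_direction_sub.
have : u - t *: (q - v) \in direction [set x | P x /\ l x = l v].
  apply: facet_direction => //; first by rewrite memvB// memvZ.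
  by rewrite linearB linearZ/= divfK ?lt_eqF// subrr.
rewrite FF' => /(@functional_direction _ _ _ l' (l' v)) H.
have /eqP : l' (u - t *: (q - v)) = 0.
  by apply: H; [exists v|move=> x []].
rewrite linearB subr_eq0 linearZ/= => /eqP ->.
by rewrite mulr_ge0_le0// linearB subr_le0 l'v.
Qed.

Lemma simple_vertex_facets P p v : simple_polytope P -> adim P = Posz p -> vertex P v ->
  exists m : 'I_p -> {scalar V}, [/\ forall i x, P x -> m i x <= m i v,
    forall i, facet P [set x | P x /\ m i x = m i v] &
    forall F, facet P F -> F v -> exists i, F = [set x | P x /\ m i x = m i v]].
Proof.
move=> [Ppoly Psimp] dP Pv; have := Psimp v Pv; rewrite dP absz_nat.
move=> /card_set_bijP[N [Nfun Ninj Nsurj]].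
have /choice[m mP] : forall i : 'I_p, exists l : {scalar V},
    [/\ forall x, P x -> l x <= l v, facet P [set x | P x /\ l x = l v] &
     N [set x | P x /\ l x = l v] = i].
  move=> i; have [F [fF Fv] NF] := Nsurj i (ltn_ord i).
  have [[l [c [lc FE]]] _] := fF; exists l.
  have lv : l v = c by move: Fv; rewrite FE => -[].
  by rewrite lv -FE.
exists m; split.
- by move=> i; have [] := mP i.
- by move=> i; have [] := mP i.
- move=> F fF Fv; have NF := Nfun F (conj fF Fv).
  exists (Ordinal NF); have [_ fG NG] := mP (Ordinal NF).
  apply: Ninj; [exact/mem_set|apply/mem_set|by rewrite NG].
  by split=> //; split=> //; exact: vertex_mem.
Qed.

(** At a simple vertex the polytope looks like an orthant: the facets through
    [v] are the coordinate hyperplanes of a frame with origin [v] whose axes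
    carry points [q i] of [P].  The functionals that cut out the facets have no
    common zero because [v] is extreme; as there are [dim P] of them, they have
    a dual basis. *)
Lemma simple_vertex_frame P p v : simple_polytope P -> adim P = Posz p -> vertex P v ->
  exists (q : 'I_p -> V) (s : 'I_p -> {scalar V}),
  [/\ forall i, P (q i) /\ forall j, s j (q i - v) = (i == j)%:R,
      forall i x, P x -> 0 <= s i (x - v),
      forall x, P x -> x - v = \sum_i s i (x - v) *: (q i - v),
      forall i, facet P [set x | P x /\ s i (x - v) = 0] &
      forall F, facet P F -> F v -> exists i, F = [set x | P x /\ s i (x - v) = 0]].
Proof.
move=> Psimp dP vP; have [m [mv mF Fm]] := simple_vertex_facets Psimp dP vP.
have Pv := vertex_mem vP.
have [n [a PE]] := polytope_range Psimp.1.
have cone u : u \in direction P -> (forall i, m i u <= 0) ->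
    exists2 e : R, 0 < e & P (v + e *: u).
  move=> uP mu.
  have [[t [t0 ->]]|ncone] := pselect (exists t : 'I_n -> R, (forall i, 0 <= t i) /\
      u = \sum_i t i *: (a i - v)).
    by rewrite PE; apply: cone_move => //; rewrite -PE.
  have [|j|l [_ lu lv fG]] :=
    @facet_separation _ _ n a P v _ (fun i => a i - v) u PE Pv _ _ uP ncone.
  - by move=> i; exists i.
  - by exists j; left.
  have [|i GE] := Fm _ fG; first by [].
  have := @facet_functional_sign P (m i) l v u Pv (mv i) lv (mF i) (esym GE) uP (mu i).
  by rewrite leNgt lu.
have ker0 u : u \in direction P -> (forall i, m i u = 0) -> u = 0.
  move=> uP mu.
  have [|e e0 Pe] := cone u uP; first by move=> i; rewrite mu.
  have [||e' e'0 Pe'] := cone (- u).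
  - by rewrite memvN.
  - by move=> i; rewrite linearN/= mu oppr0.
  pose t := e' / (e + e').
  have ee0 : 0 < e + e' by rewrite addr_gt0.
  have [|||/= + _] := @face_convex _ _ P [set v] (v + e *: u) (v + e' *: - u) t vP Pe Pe'.
  - by rewrite divr_gt0.
  - by rewrite ltr_pdivrMr// mul1r ltrDr.
  - rewrite /= !scalerDr addrACA -scalerDl !scalerA scalerN -scalerBl.
    have -> : t + (1 - t) = 1 by ring.
    have -> : t * e - (1 - t) * e' = 0 by rewrite /t; field; rewrite gt_eqF.
    by rewrite scale1r scale0r addr0.
  move=> /eqP; rewrite addrC -subr_eq0 addrK scaler_eq0 gt_eqF//=.
  by move=> /eqP.
have [|M ME] := @linear_of R V 'rV[R]_p (fun x => \row_i m i x).
  by move=> c x y; apply/rowP => i; rewrite !mxE linearP.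
have imgM : (linfun M @: direction P)%VS = fullv.
  apply/eqP; rewrite eqEdim subvf/= dimvf/= /dim/= mul1n.
  have := limg_ker_dim (linfun M) (direction P).
  have -> : (direction P :&: lker (linfun M) = 0)%VS.
    apply/eqP; rewrite -subv0; apply/subvP => u; rewrite memv_cap memv_ker lfunE/=.
    move=> /andP[uP /eqP Mu]; rewrite memv0; apply/eqP/ker0 => // i.
    by have := congr1 (fun r : 'rV[R]_p => r 0 i) Mu; rewrite /= ME !mxE.
  rewrite dimv0 add0n => ->.
  by move: dP; rewrite adimE; [case=> ->|exists v].
have /choice[e eP] : forall i, exists u, u \in direction P /\
    forall j, m j u = - (i == j)%:R.
  move=> i; have : (\row_j - (i == j)%:R : 'rV[R]_p) \in (linfun M @: direction P)%VS.
    by rewrite imgM memvf.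
  move=> /memv_imgP[u uP]; rewrite lfunE/= ME => uE; exists u; split=> // j.
  by have := congr1 (fun r : 'rV[R]_p => r 0 j) uE; rewrite !mxE.
have /choice[d dPP] : forall i, exists d : R, 0 < d /\ P (v + d *: e i).
  move=> i; have [eD em] := eP i.
  have [|d d0 Pd] := cone _ eD; first by move=> j; rewrite em oppr_le0.
  by exists d.
have /choice[s sE] : forall i, exists s : {scalar V}, forall x, s x = - (m i x / d i).
  move=> i; have [s sE] := functional_comb (m i) (m i) (- (d i)^-1) 0.
  by exists s => x; rewrite sE mul0r addr0 mulNr mulrC.
have d0 i : d i != 0 by have [/gt_eqF ->] := dPP i.
have q_s i j : s j (v + d i *: e i - v) = (i == j)%:R.
  rewrite addrAC subrr add0r sE scalarZ (eP i).2 mulrN mulNr opprK.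
  by case: eqVneq => [->|_]; rewrite ?mulr1 ?divff// mulr0 mul0r.
have FE i : [set x | P x /\ s i (x - v) = 0] = [set x | P x /\ m i x = m i v].
  apply/seteqP; split=> x /= [Px]; rewrite sE linearB/=.
    move=> /eqP; rewrite oppr_eq0 mulf_eq0 invr_eq0 (negPf (d0 i)) orbF subr_eq0.
    by move=> /eqP.
  by move=> ->; rewrite subrr mul0r oppr0.
exists (fun i => v + d i *: e i), s; split.
- by move=> i; split; [have [] := dPP i|exact: q_s].
- move=> i x Px; rewrite sE oppr_ge0 pmulr_lle0 ?invr_gt0; last by have [] := dPP i.
  by rewrite linearB subr_le0 mv.
- move=> x Px; apply/eqP; rewrite -subr_eq0; apply/eqP/ker0.
    rewrite memvB ?mem_direction_sub// memv_suml// => i _.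
    by rewrite memvZ// mem_direction_sub//; have [] := dPP i.
  move=> j; suff : s j (x - v - \sum_i s i (x - v) *: (v + d i *: e i - v)) = 0.
    move=> /eqP; rewrite sE oppr_eq0 mulf_eq0 invr_eq0 (negPf (d0 j)) orbF.
    by move=> /eqP.
  rewrite (linearB (s j)) linear_sum (bigD1 j)//= linearZ/= q_s eqxx mulr1.
  rewrite big1 ?addr0 ?subrr// => i ij.
  by rewrite linearZ/= q_s (negPf ij) mulr0.
- by move=> i; rewrite FE.
- by move=> F fF Fv; have [i ->] := Fm F fF Fv; exists i; rewrite FE.
Qed.

End SimpleVertices.

(** * Maps that are affine on every proper face *)

Section Gluing.
Variables (R : realType) (V W : vectType R).
Implicit Types (P F : set V) (v w x y : V) (l : {scalar V}).
Variables (P : set V) (h : V -> W).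
Hypothesis h_affine : forall F, proper_face P F ->
  exists (L : {linear V -> W}) (b : W), forall x, F x -> h x = L x + b.

Lemma facet_proper F : facet P F -> proper_face P F.
Proof.
move=> [fF dF]; split=> // FP; move: dF; rewrite FP => /eqP.
by rewrite -subr_eq0 opprB addrC subrK oner_eq0.
Qed.

Lemma affine_frame_sum (L : {linear V -> W}) b n (c : 'I_n -> R) v (y : 'I_n -> V) :
  L (v + \sum_i c i *: (y i - v)) + b =
  (L v + b) + \sum_i c i *: ((L (y i) + b) - (L v + b)).
Proof.
rewrite linearD linear_sum addrAC; congr (_ + _); apply: eq_bigr => i _.
by rewrite linearZ/= linearB/= opprD addrACA subrr addr0.
Qed.

(** In dimension at least three the affine map determined by [h] on the frame at
    a vertex [v] extends [h] on all facets through [v].  When [l] can be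
    increased from [v], it increases along an axis of the frame; the
    corresponding axis point is a convex combination of vertices lying on all
    facets through [v] but one.  Any two such facets contain the whole frame
    between them, so at these vertices the affine map is the same. *)
Lemma simple_vertex_extension p v : simple_polytope P -> adim P = Posz p -> (3 <= p)%N ->
  vertex P v -> exists (L : {linear V -> W}) (b : W),
  (forall F, facet P F -> F v -> forall x, F x -> h x = L x + b) /\
  forall l y, P y -> l v < l y -> exists w, [/\ vertex P w, l v < l w &
    forall (L' : {linear V -> W}) b',
      (forall F, facet P F -> F w -> forall x, F x -> h x = L' x + b') ->
      forall x, P x -> L' x + b' = L x + b].
Proof.
move=> Psimp dP p3 vP.
have [q [s [qs s0 sE sF Fs]]] := simple_vertex_frame Psimp dP vP.
have Pv := vertex_mem vP.
have [L0 L0E] := @linear_of R V W (fun x => \sum_i s i x *: (h (q i) - h v))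
  ltac:(by move=> c x y; rewrite scaler_sumr -big_split; apply: eq_bigr => i _;
    rewrite /= linearP scalerDl scalerA).
have LE x : L0 x + (h v - L0 v) = h v + \sum_i s i (x - v) *: (h (q i) - h v).
  rewrite addrCA; congr (_ + _); rewrite -linearB L0E; apply: eq_bigr => i _.
  by rewrite linearB.
have Fq i j : i != j -> P (q i) /\ s j (q i - v) = 0.
  by move=> ij; have [Pq qE] := qs i; rewrite qE (negPf ij).
have hF F : facet P F -> F v -> forall x, F x -> h x = L0 x + (h v - L0 v).
  move=> fF Fv x Fx; have [L [b Lb]] := h_affine (facet_proper fF).
  have Px := face_sub fF.1 Fx.
  have [j FE] := Fs F fF Fv.
  rewrite LE Lb// -[in LHS](subrKC v x) [in LHS](sE x Px) affine_frame_sum -Lb//.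
  congr (_ + _); apply: eq_bigr => i _.
  have [ij|ij] := eqVneq i j.
    have -> : s i (x - v) = 0 by rewrite ij; move: Fx; rewrite FE => -[].
    by rewrite !scale0r.
  by rewrite -Lb// FE; exact: Fq.
exists L0, (h v - L0 v); split=> // l y Py lvy.
have [i li] : exists i, l v < l (q i).
  apply: contrapT => /forallNP nl.
  have : l (y - v) <= 0.
    rewrite (sE y Py) linear_sum; apply: sumr_le0 => i _; rewrite linearZ/=.
    rewrite mulr_ge0_le0 ?s0// linearB subr_le0 leNgt.
    by apply/negP/nl.
  by rewrite linearB subr_le0 leNgt lvy.
have [n [a [_ PE Pa]]] := polytope_vertices Psimp.1.
have aP k : P (a k) by exact: mem_range_hull PE.
have := (qs i).1; rewrite {1}PE => /convex_hull_range[t [t0 t1 qE]].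
have [k tk lk] : exists2 k, 0 < t k & l v < l (a k).
  apply: contrapT => nk.
  have : l (q i) <= l v.
    rewrite qE linear_sum -[leRHS]mul1r -t1 mulr_suml; apply: ler_sum => k _.
    rewrite linearZ/=; have [->|tk] := eqVneq (t k) 0; first by rewrite !mul0r.
    rewrite ler_wpM2l// leNgt; apply/negP => lk; apply: nk; exists k => //.
    by rewrite lt_neqAle eq_sym tk t0.
  by rewrite leNgt li.
exists (a k); split=> //; first by apply/Pa; exists k.
move=> L' b' hL' x Px.
have ak j : i != j -> s j (a k - v) = 0.
  move=> ij; have fF := (sF j).1.
  have [] // := face_weights fF aP t0 t1 _ tk.
  by rewrite -qE; exact: Fq.
have agree j y' : i != j -> P y' -> s j (y' - v) = 0 -> L' y' + b' = L0 y' + (h v - L0 v).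
  move=> ij Py' sy'; have fF := sF j.
  by rewrite -(hL' _ fF)// -?(hF _ fF)//; split=> //; rewrite ?subrr ?linear0//; exact: ak.
(* As there are at least three indices, each frame point [q j] lies on a facet
   [j'] through [v] that also passes through [a k]. *)
have two j : exists2 j', i != j' & j != j'.
  apply: contrapT => nj.
  have : (#|'I_p| <= #|[set i; j]%SET|)%N.
    apply: subset_leq_card; apply/fintype.subsetP => j' _; rewrite !inE.
    apply/negPn/negP; rewrite negb_or => /andP[ij' jj'].
    by apply: nj; exists j'; rewrite eq_sym.
  rewrite card_ord cards2 => /(leq_trans p3); by case: (_ != _).
have agree_v : L' v + b' = L0 v + (h v - L0 v).
  have [j ij _] := two i; apply: (agree j) => //.
  by rewrite subrr linear0.
have agree_q j : L' (q j) + b' = L0 (q j) + (h v - L0 v).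
  have [j' ij' jj'] := two j; have [Pq sq] := Fq j j' jj'.
  exact: agree ij' Pq sq.
rewrite -(subrKC v x) (sE x Px) !affine_frame_sum agree_v; congr (_ + _).
by apply: eq_bigr => j _; rewrite agree_q.
Qed.

Lemma facet_vertex n (a : 'I_n -> V) F x : P = convex_hull (range a) ->
  face P F -> F x -> exists i, F (a i).
Proof.
move=> PE fF Fx; have := face_sub fF Fx.
rewrite {1}PE => /convex_hull_range[t [t0 t1 xE]].
have [i ti] := positive_weight t0 t1; exists i.
by apply: (face_weights fF _ t0 t1 _ ti) => [j|]; [exact: mem_range_hull PE|rewrite -xE].
Qed.

(** The affine maps at the vertices coincide: fix a vertex [a i0] exposed by [l].
    Among the vertices with a different map, one where [l] is largest has a
    neighbour where [l] is larger and the map is the same. *)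
Lemma simple_polytope_extension p : simple_polytope P -> adim P = Posz p -> (3 <= p)%N ->
  exists (L : {linear V -> W}) (b : W),
    forall F, proper_face P F -> forall x, F x -> h x = L x + b.
Proof.
move=> Psimp dP p3.
have [n [a [ainj PE Pa]]] := polytope_vertices Psimp.1.
have aP k : P (a k) by exact: mem_range_hull PE.
have av i : vertex P (a i) by apply/Pa; exists i.
have /choice[L LP] : forall i, exists Lb : {linear V -> W} * W,
  (forall F, facet P F -> F (a i) -> forall x, F x -> h x = Lb.1 x + Lb.2) /\
  forall l y, P y -> l (a i) < l y -> exists w, [/\ vertex P w, l (a i) < l w &
    forall (L' : {linear V -> W}) b',
      (forall F, facet P F -> F w -> forall x, F x -> h x = L' x + b') ->
      forall x, P x -> L' x + b' = Lb.1 x + Lb.2].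
  move=> i; have [L [b Lb]] := simple_vertex_extension Psimp dP p3 (av i).
  by exists (L, b).
have [i0] : exists i0 : 'I_n, True.
  have [x Px] : P !=set0.
    by apply/set0P/eqP => P0; move: dP; rewrite /adim; case: asboolP.
  move: Px; rewrite PE => /convex_hull_range[t [t0 t1 _]].
  by have [i _] := positive_weight t0 t1; exists i.
move=> _.
have [l [c [lc avE]]] := av i0.
pose bad i := ~ forall x, P x -> (L i).1 x + (L i).2 = (L i0).1 x + (L i0).2.
have good i : ~ bad i.
  move=> bi; have bi' : `[< bad i >] by apply/asboolP.
  case: (@arg_maxP _ R _ i (fun i => `[< bad i >]) (fun i => l (a i)) bi')
    => j /asboolP bj jmax.
  have lj : l (a j) < l (a i0).
    have [_ lc0] : P (a i0) /\ l (a i0) = c.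
      by have : [set a i0] (a i0) by []; rewrite avE.
    rewrite lt_neqAle lc0 lc// andbT; apply/eqP => lj; apply: bj.
    have : [set a i0] (a j) by rewrite avE.
    by move=> /ainj ->.
  have [w [wP lw Lw]] := (LP j).2 l (a i0) (aP i0) lj.
  have [j' wE] := (Pa w).1 wP; rewrite {}wE in wP lw Lw.
  have bj' : `[< bad j' >].
    apply/asboolP => gj'; apply: bj => x Px.
    by rewrite -gj'// (Lw _ _ (LP j').1).
  by have := le_lt_trans (jmax j' bj') lw; rewrite ltxx.
exists (L i0).1, (L i0).2 => F pF x Fx.
have [m [mx fG FG]] := proper_face_facet Psimp.1 pF Fx.
have [j Gj] := facet_vertex PE fG.1 (FG _ Fx).
rewrite ((LP j).1 _ fG Gj)//; last exact: FG.
have /contrapT := good j; apply; exact: face_sub pF.1 _ Fx.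
Qed.

(** The dimension forces the points to be affinely independent. *)
Lemma affine_through_points n (a : 'I_n.+1 -> V) (y : 'I_n.+1 -> W) :
  (n <= \dim (direction (convex_hull (range a))))%N ->
  exists (L : {linear V -> W}) (b : W), forall i, L (a i) + b = y i.
Proof.
pose X := [tuple a (lift ord0 i) - a ord0 | i < n].
have XE (i : 'I_n) : X`_i = a (lift ord0 i) - a ord0 by rewrite -tnth_nth tnth_mktuple.
have le : (direction (convex_hull (range a)) <= <<X>>)%VS.
  have a0 : convex_hull (range a) (a ord0) by apply: sub_convex_hull; exists ord0.
  rewrite (direction_range a0); apply/span_subvP => x /mapP[i _ ->].
  have [j ->|->] := unliftP ord0 i; last by rewrite subrr mem0v.
  by rewrite -XE memv_span// mem_nth// size_tuple.
move=> nle.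
have fX : free X.
  rewrite /free size_tuple eqn_leq; apply/andP; split.
    by rewrite -{2}(size_tuple X) dim_span.
  exact: leq_trans nle (dimvS le).
have [|L LE] := @linear_of R V W
    (fun x => \sum_i coord X i x *: (y (lift ord0 i) - y ord0)).
  move=> c u v; rewrite scaler_sumr -big_split; apply: eq_bigr => i _ /=.
  by rewrite linearP scalerDl scalerA.
exists L, (y ord0 - L (a ord0)) => i; rewrite addrCA -linearB.
have [j ->|->] := unliftP ord0 i; last by rewrite subrr linear0 addr0.
rewrite -XE LE (bigD1 j)//= coord_free// eqxx scale1r big1 ?addr0 ?subrKC//.
by move=> i' /negPf; rewrite eq_sym coord_free// => ->; rewrite scale0r.
Qed.

Lemma few_vertices_extension n (a : 'I_n.+1 -> V) : P = convex_hull (range a) ->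
  (n <= \dim (direction P))%N ->
  exists (L : {linear V -> W}) (b : W),
    forall F, proper_face P F -> forall x, F x -> h x = L x + b.
Proof.
move=> PE; rewrite {1}PE => /(@affine_through_points _ _ (fun i => h (a i)))[L [b Lb]].
exists L, b => F pF x Fx; have [LF [bF LbF]] := h_affine pF.
have := face_sub pF.1 Fx; rewrite {1}PE => /convex_hull_range[t [t0 t1 xE]].
rewrite LbF// xE !affine_sum//; apply: eq_bigr => i _.
have [->|ti] := eqVneq (t i) 0; first by rewrite !scale0r.
rewrite Lb -LbF//; apply: (face_weights pF.1 _ t0 t1).
- by move=> j; exact: mem_range_hull PE.
- by rewrite -xE.
- by rewrite lt_neqAle eq_sym ti t0.
Qed.

End Gluing.

Section LowDimension.
Variables (R : realType) (V : vectType R).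

(** A functional that is injective on [P] attains its extremes at two vertices;
    any other vertex would lie strictly between these. *)
Lemma segment_vertices n (a : 'I_n -> V) (P : set V) : injective a ->
  P = convex_hull (range a) -> (forall i, vertex P (a i)) -> adim P = 1 -> (n <= 2)%N.
Proof.
move=> ainj PE av dP.
have aP k : P (a k) by exact: mem_range_hull PE.
have P0 : P !=set0.
  by apply/set0P/eqP => P0; move: dP; rewrite /adim; case: asboolP.
have d1 : \dim (direction P) = 1%N by move: dP; rewrite adimE// => -[].
pose e := vpick (direction P).
have e0 : e != 0 by rewrite vpick0 -dimv_eq0 d1.
have DE : direction P = <[e]>%VS.
  apply/eqP; rewrite eq_sym eqEdim dim_vline e0 d1 andbT.
  by rewrite -memvE memv_pick.
have [l le] := functional_nonzero e0.
have l_inj u : u \in direction P -> l u = 0 -> u = 0.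
  by rewrite DE => /vlineP[c ->]; rewrite linearZ/= le mulr1 => ->; rewrite scale0r.
have linj i j : l (a i) = l (a j) -> i = j.
  move=> lij; apply: ainj; apply/eqP; rewrite -subr_eq0; apply/eqP/l_inj.
    exact: mem_direction_sub.
  by rewrite linearB/= lij subrr.
have [->//|/= i0] : n = 0%N \/ exists i : 'I_n, True.
  by case: (n) => [|n']; [left|right; exists ord0].
have [i _] := i0.
case: (@arg_maxP _ R _ i xpredT (fun i => l (a i)) isT) => imax _ /(_ _ isT) lmax.
case: (@arg_minP _ R _ i xpredT (fun i => l (a i)) isT) => imin _ /(_ _ isT) lmin.
have : (#|'I_n| <= #|[set imin; imax]%SET|)%N.
  apply: subset_leq_card; apply/fintype.subsetP => j _; rewrite !inE.
  apply/negPn/negP; rewrite negb_or => /andP[jmin jmax].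
  have l1 : l (a imin) < l (a j).
    by rewrite lt_neqAle [_ <= _]lmin andbT; apply: contra jmin => /eqP/linj ->.
  have l2 : l (a j) < l (a imax).
    by rewrite lt_neqAle [_ <= _]lmax andbT; apply: contra jmax => /eqP/linj ->.
  pose t := (l (a j) - l (a imin)) / (l (a imax) - l (a imin)).
  have d0 : 0 < l (a imax) - l (a imin) by rewrite subr_gt0 (lt_trans l1).
  have aE : a j = t *: a imax + (1 - t) *: a imin.
    apply/eqP; rewrite -subr_eq0; apply/eqP.
    have -> : a j - (t *: a imax + (1 - t) *: a imin) =
        (a j - a imin) - t *: (a imax - a imin).
      rewrite scalerBl scale1r scalerBr !opprD !opprK !addrA.
      by congr (_ + _); exact: addrAC.
    apply: l_inj; first by rewrite memvB ?memvZ// mem_direction_sub.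
    by rewrite linearB scalarZ !linearB/= divfK ?gt_eqF// subrr.
  have [|||/= + _] := @face_convex _ _ P [set a j] (a imax) (a imin) t (av j) (aP _) (aP _).
  - by rewrite divr_gt0// subr_gt0.
  - by rewrite ltr_pdivrMr// mul1r ltrD2r.
  - by rewrite -aE.
  by move=> /ainj ij; rewrite ij eqxx in jmax.
by rewrite card_ord cards2 => /leq_trans; apply; case: (_ != _).
Qed.

End LowDimension.

(** * Surjectivity for simple polytopes *)

Section Surjectivity.
Variable R : realType.
Variables (m n k : nat) (Y : set 'rV[R]_m) (X : set 'rV[R]_n)
  (P : set 'rV[R]_k) (f : Y -> 'rV[R]_n).
Hypotheses (Y_nonempty : Y !=set0) (Y_convex : convex_set Y)
  (X_compact : compact X) (X_convex : convex_set X) (f_affine : affine_hom X f)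
  (P_polytope : polytope P) (dim_f : adim (range f) = adim X)
  (dim_P : adim X <= adim P).

(** Let [K] be the relative interior of the image of [f], and suppose that [g]
    meets [K], at [g z] say.  If [g] were constant on a line through [z], that
    line would leave [P] at a boundary point with image [g z].  So [g] is
    injective, and the direction of [P] is mapped onto that of [X].  Thus any
    point of the image of [f] has a preimage in the affine hull of [P]; if it were
    outside [P], the segment from [z] to it would leave [P] at a boundary point
    with image in [K]. *)
Lemma boundary_avoiding_sandwiching (g : P -> 'rV[R]_n) : affine_hom X g ->
  (forall x : P, boundary P (set_val x) -> ~ relint (range f) (g x)) ->
  (sandwiching X f P `|` complementing X f P) g.
Proof.
move=> gh gB; have [L [b gE]] := affine_map_extension gh.1.
have [[_ [[z _ <-] Kz]]|nK] := pselect (exists y, (range g `&` relint (range f)) y);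
  last first.
  right; apply/(complementingP Y_nonempty X_compact f_affine.2 dim_f); split=> //.
  by apply/seteqP; split=> // y Hy; apply: nK; exists y.
left; split=> // y fy.
have Pz := set_valP z.
have nB x : boundary P x -> ~ relint (range f) (L x + b).
  by move=> Bx; have := gB (point_of Bx.1) Bx; rewrite gE.
have Linj u : u \in direction P -> L u = 0 -> u = 0.
  move=> uP Lu; apply/eqP/negPn/negP => u0.
  have [t _ Bt] := ray_exit (polytope_compact P_polytope) Pz uP u0.
  by have := nB _ Bt; rewrite linearD linearZ/= Lu scaler0 addr0 -gE.
have gX x : X (g x) by apply: gh.2; exists x.
have gz : X (g z) by [].
have imgX : (linfun L @: direction P <= direction X)%VS.
  apply/subvP => _ /memv_imgP[u uP ->]; rewrite lfunE/=.
  move: uP => /directionP[|x [x' [Px Px' ->]]]; first by exists (set_val z).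
  have LX w : affine_hull P w -> affine_hull X (L w + b).
    move=> [r [w' [t [Pw' t1 ->]]]]; rewrite affine_sum//.
    exists r, (fun i => L (w' i) + b), t; split=> // i.
    by have := gX (point_of (Pw' i)); rewrite gE.
  have := mem_direction (LX _ Px) (LX _ Px').
  by rewrite opprD addrACA subrr addr0 -linearB.
have /eqP imgE : (linfun L @: direction P)%VS == direction X.
  rewrite eqEdim imgX /=.
  have := limg_ker_dim (linfun L) (direction P).
  have -> : (direction P :&: lker (linfun L) = 0)%VS.
    apply/eqP; rewrite -subv0; apply/subvP => u; rewrite memv_cap memv_ker lfunE/=.
    by move=> /andP[uP /eqP Lu]; rewrite memv0; apply/eqP/Linj.
  rewrite dimv0 add0n => ->.
  move: dim_P; rewrite !adimE ?lez_nat//; first by exists (set_val z).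
  by exists (g z).
have : y - g z \in (linfun L @: direction P)%VS.
  by rewrite imgE mem_direction_sub//; exact: f_affine.2.
move=> /memv_imgP[u uP]; rewrite lfunE/= => uE.
have Lzu : L (set_val z + u) + b = y.
  by rewrite linearD -uE addrAC -gE subrKC.
have [Pzu|nPzu] := pselect (P (set_val z + u)).
  by exists (point_of Pzu) => //; rewrite gE.
have [||t [t0 t1 Bt]] := segment_exit _ Pz _ nPzu.
- by apply: compact_closed; [exact: norm_hausdorff|exact: polytope_compact].
- by apply: affine_hull_direction => //; exact: sub_affine_hull.
exfalso; apply: (nB _ Bt).
have -> : L (set_val z + t *: (set_val z + u - set_val z)) + b = g z + t *: (y - g z).
  by rewrite addrAC subrr add0r linearD linearZ/= -uE addrAC -gE.
by apply: relint_segment => //; exact: range_convex f_affine.1.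
Qed.

Lemma simple_restrict_boundary_surj : simple_polytope P ->
  ~ (exists N : nat, (4 <= N)%N /\ ngon N P) ->
  set_surj (sandwiching X f P `|` complementing X f P) (lim_complementing X f P)
    (restrict_boundary P).
Proof.
move=> Psimp nngon c [_ cX cF].
have [N [a [ainj PE Pa]]] := polytope_vertices P_polytope.
have aP i : P (a i) by exact: mem_range_hull PE.
have av i : vertex P (a i) by apply/Pa; exists i.
have [x0 Xx0] : X !=set0.
  by have [y fy] := range_nonempty f Y_nonempty; exists y; exact: f_affine.2.
have [x Px] : P !=set0.
  apply/set0P/eqP => P0; move: dim_P; rewrite P0 {2}/adim asboolT//.
  by apply/negP; rewrite -ltNge (lt_le_trans _ (adim_ge0 (ex_intro _ x0 Xx0))).
have [Pi|nPi] := pselect (exists i, P = [set a i]).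
  have [i Pi'] := Pi.
  have B0 y : ~ boundary P y.
    move=> /(boundary_proper_face P_polytope)[F [pF Fy]]; apply: pF.2.
    apply/seteqP; split; first exact: face_sub pF.1.
    have P1 w : P w -> w = a i by rewrite Pi'.
    by move=> w /P1 ->; rewrite -(P1 _ (face_sub pF.1 Fy)).
  exists (fun=> x0); last by apply/funext => y; have := B0 _ (set_valP y).
  apply: boundary_avoiding_sandwiching => [|z /B0//].
  split=> [r z t z' t1 _|_ [_ _ <-]//].
  by rewrite -scaler_suml t1 scale1r.
pose h y := if pselect (boundary P y) is left By then c (point_of By) else 0.
have hE (y : boundary P) : h (set_val y) = c y.
  rewrite /h; case: pselect => [By|]; last by move=> /(_ (set_valP y)).
  by congr c; exact: val_inj.
have h_affine F : proper_face P F -> exists (L : {linear 'rV[R]_k -> 'rV[R]_n}) b,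
    forall y, F y -> h y = L y + b.
  move=> pF; have [L [b Lb]] := affine_map_extension (cF F pF).1.
  exists L, b => y Fy; rewrite -(Lb (point_of Fy)) /=.
  by rewrite -hE.
have [L [b Lb]] : exists (L : {linear 'rV[R]_k -> 'rV[R]_n}) b,
    forall F, proper_face P F -> forall y, F y -> h y = L y + b.
  have P0 : P !=set0 by exists x.
  have [p3|p3] := leqP 3 (\dim (direction P)).
    by apply: (simple_polytope_extension h_affine Psimp _ p3); rewrite adimE.
  have Np : (N <= (\dim (direction P)).+1)%N.
    have := adimE P0; move: p3; case: (\dim _) => [|[|[|//]]] _ dP.
    - rewrite leqNgt; apply/negP => N1.
      have := @adim_le0 _ _ P (a (Ordinal N1)) (a (Ordinal (ltnW N1))).
      by rewrite dP => /(_ (lexx _) (aP _) (aP _)) /ainj.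
    - exact: segment_vertices ainj PE av dP.
    - rewrite leqNgt; apply/negP => N3; apply: nngon; exists N; split=> //.
      split=> //; have -> : vertex P = a @` [set: 'I_N].
        by apply/seteqP; split=> [w /Pa[i ->]|_ [i _ <-]//]; exists i.
      apply: card_eq_trans (inj_card_eq _) _; last by rewrite card_eq_sym card_II.
      by move=> i j _ _; exact: ainj.
  case: N => [|N] in a ainj PE Pa aP av nPi Np *.
    move: Px; rewrite PE => /convex_hull_range[t [_ + _]].
    by rewrite big_ord0 => /esym/eqP; rewrite oner_eq0.
  by apply: (few_vertices_extension h_affine PE); rewrite -ltnS.
have LB y : boundary P y -> h y = L y + b.
  by move=> /(boundary_proper_face P_polytope)[F [pF Fy]]; exact: Lb pF _ Fy.
have cE (y : boundary P) : c y = L (set_val y) + b.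
  by rewrite -LB ?hE//; exact: set_valP.
exists (fun y : P => L (set_val y) + b); last by apply/funext => y; rewrite cE.
apply: boundary_avoiding_sandwiching.
  split; first exact: affine_map_restriction.
  move=> _ [y _ <-]; have : P (set_val y) by exact: set_valP.
  rewrite {1}PE => /convex_hull_range[t [t0 t1 ->]].
  rewrite affine_sum//; apply: convex_comb => // i.
  have ba : boundary P (a i).
    by apply: vertex_boundary => // Pi; apply: nPi; exists i.
  by rewrite -(cE (point_of ba)); apply: cX; exists (point_of ba).
move=> y By; have [F [pF Fy]] := boundary_proper_face P_polytope By.
have [_ /(complementingP Y_nonempty X_compact f_affine.2 dim_f)[_ cK]] := cF F pF.
rewrite -(cE (point_of By)) => Ky.
suff : set0 (c (point_of By)) by [].
rewrite -cK; split=> //; exists (point_of Fy) => //=.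
by congr c; exact: val_inj.
Qed.

End Surjectivity.

(* The hypothesis [adim X < adim P -> sandwiching X f P = set0] is not in the
   source. It is vacuous when dim X = dim P. When dim X < dim P, restriction to
   the boundary maps no element of S(P, f) into the limit, because an affine map
   g : P -> X then satisfies g(P) = g(boundary of P); so the map rho exists only
   if S(P, f) is empty. *)
Theorem theorem8p7 (R : realType) (m n k : nat)
    (Y : set 'rV[R]_m) (X : set 'rV[R]_n) (P : set 'rV[R]_k)
    (f : Y -> 'rV[R]_n)
    (Y_nonempty : Y !=set0)
    (Y_compact : compact Y) (Y_convex : @convex_set R 'rV[R]_m Y)
    (X_compact : compact X) (X_convex : @convex_set R 'rV[R]_n X)
    (f_affine : affine_hom X f)
    (P_polytope : polytope P)
    (dim_f : adim (range f) = adim X)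
    (dim_P : adim X <= adim P)
    (S_empty : adim X < adim P -> sandwiching X f P = set0) :
  let SC := sandwiching X f P `|` complementing X f P in
  let L := lim_complementing X f P in
  let rho := restrict_boundary P in
  [/\ [/\ set_fun SC L rho,
          affine_map (fun g : SC => rho (set_val g)) &
          set_inj SC rho],
      simple_polytope P ->
        ~ (exists N : nat, (4 <= N)%N /\ ngon N P) ->
        set_bij SC L rho &
      range f `<=` relint X ->
        (exists v : 'rV[R]_k,
          [/\ vertex P v,
              forall F, facet P F -> F v -> simplex F &
              ~ pyramid_with_apex P v]) ->
        ~ set_bij SC L rho].
Proof.
move=> SC L rho.
have rho_fun : set_fun SC L rho.
  exact: (restrict_boundary_fun Y_nonempty X_compact f_affine.2 dim_f dim_P S_empty).
have rho_inj : set_inj SC rho.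
  exact: (restrict_boundary_inj Y_nonempty X_compact f_affine.2 dim_f P_polytope dim_P).
split; first split=> //.
- move=> r g t g' t1 gE; apply/funext => x.
  rewrite fct_sumE /rho /restrict_boundary gE /= fct_sumE.
  by [].
- move=> Psimp nngon; split=> //.
  exact: (simple_restrict_boundary_surj Y_nonempty Y_convex).
- move=> fX [v [Pv Fsimp npyr]] [_ _]; move: npyr.
  exact: (restrict_boundary_not_surj Y_nonempty Y_compact).
Qed.
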